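(* Let $\ell\in\mathbb N-\frac12$ and $d\in\mathbb N$. For $d\neq 2$, $$\operatorname{Der}\widehat{\mathfrak g}^{\,M}_\ell(d)=\operatorname{Inn}\widehat{\mathfrak g}^{\,M}_\ell(d)\oplus\mathbb C\delta_M .$$ For $d=2$, $$\operatorname{Der}\widehat{\mathfrak g}^{\,M}_\ell(2)=\operatorname{Inn}\widehat{\mathfrak g}^{\,M}_\ell(2)\oplus\mathbb C\delta_M\oplus\mathbb C\eta_M .$$
   Context: All algebras are over $\mathbb C$; $\mathbb N=\{1,2,\dots\}$, so $\mathbb N-\frac12=\{\frac12,\frac32,\dots\}$. $\operatorname{Der}$ denotes the derivation algebra and $\operatorname{Inn}$ the inner derivations; $\oplus$ is a direct sum of vector spaces. The mass central extension $\widehat{\mathfrak g}^{\,M}_\ell(d)$ has basis $D,H,C$, $M_{ij}$ ($1\le i<j\le d$, with $M_{ji}=-M_{ij}$), $P_i^{(n)}$ ($1\le i\le d$, $0\le n\le 2\ell$), and a central element $M$, with non-zero brackets (up to skew-symmetry) $$[D,H]=2H,\quad [D,C]=-2C,\quad [C,H]=D,$$ $$[M_{ij},M_{kl}]=-\delta_{ik}M_{jl}-\delta_{jl}M_{ik}+\delta_{il}M_{jk}+\delta_{jk}M_{il},$$ $$[H,P_i^{(n)}]=-nP_i^{(n-1)},\quad [D,P_i^{(n)}]=2(\ell-n)P_i^{(n)},\quad [C,P_i^{(n)}]=(2\ell-n)P_i^{(n+1)},$$ $$[M_{ij},P_k^{(n)}]=-\delta_{ik}P_j^{(n)}+\delta_{jk}P_i^{(n)},$$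 $$[P_i^{(m)},P_j^{(n)}]=\delta_{ij}\delta_{m+n,2\ell}I_mM,\qquad I_m=(-1)^{m+\ell+\frac12}(2\ell-m)!\,m!,$$ with $P_i^{(-1)}=P_i^{(2\ell+1)}=0$. $\delta_M$ is the linear map with $\delta_M(P_i^{(n)})=P_i^{(n)}$, $\delta_M(M)=2M$, vanishing on $D,H,C,M_{ij}$. For $d=2$, put $s=-\mathrm iM_{12}$; $\eta_M$ is the linear map with $\eta_M(s)=M$ that vanishes on all the other basis elements $D,H,C,P_i^{(n)},M$. *)

(* Defs.v *)
(* Complex numbers are R[i], for R : realType. *)
From HB Require Import structures.
From mathcomp Require Import all_boot all_order all_algebra.
From mathcomp Require Import complex reals.

Set Implicit Arguments.
Unset Strict Implicit.
Unset Printing Implicit Defensive.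

Import Order.TTheory GRing.Theory Num.Theory.
Local Open Scope ring_scope.
Local Open Scope complex_scope.

Section Derivations.
Variables (K : fieldType) (V : vectType K) (br : {bilinear V -> V -> V}).

Definition ad (x : V) : 'End(V) := linfun (br x).

Definition leibniz_defect (x y : V) (f : 'End(V)) : V :=
  f (br x y) - (br (f x) y + br x (f y)).

Lemma ad_is_linear : linear ad.
Proof.
move=> a x y; apply/lfunP => z.
by rewrite !lfunE /= scale_lfunE !lfunE /= linearPl.
Qed.
HB.instance Definition _ := GRing.isLinear.Build K V 'End(V) _ ad ad_is_linear.

Lemma leibniz_defect_is_linear x y : linear (leibniz_defect x y).
Proof.
move=> a f g; rewrite /leibniz_defect !add_lfunE !scale_lfunE linearPl linearPr.
rewrite scalerBr scalerDr !opprD !addrA.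
by rewrite [RHS](ACl (1*4*2*5*3*6))%AC /=.
Qed.
HB.instance Definition _ x y :=
  GRing.isLinear.Build K 'End(V) V _ (leibniz_defect x y)
    (leibniz_defect_is_linear x y).

Definition Inn : {vspace 'End(V)} := limg (linfun ad).

(* The Leibniz rule is imposed on a basis only, so that the intersection is
   finite; DerP shows that it then holds everywhere. *)
Definition Der : {vspace 'End(V)} :=
  (\bigcap_(x <- vbasis {:V}) \bigcap_(y <- vbasis {:V})
     lker (linfun (leibniz_defect x y)))%VS.

Lemma InnP (f : 'End(V)) :
  reflect (exists x, forall y, f y = br x y) (f \in Inn).
Proof.
apply: (iffP memv_imgP) => [[x _ ->]|[x fE]]; exists x.
- by move=> y; rewrite !lfunE.
- exact: memvf.
- by apply/lfunP => y; rewrite !lfunE.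
Qed.

Lemma mem_bigcapv (W : vectType K) (I : eqType) (s : seq I)
    (F : I -> {vspace W}) (w : W) :
  (w \in (\bigcap_(i <- s) F i)%VS) = all (fun i => w \in F i) s.
Proof.
elim: s => [|i s IHs]; first by rewrite big_nil memvf.
by rewrite big_cons memv_cap IHs.
Qed.

Lemma DerP (f : 'End(V)) :
  reflect (forall x y, f (br x y) = br (f x) y + br x (f y)) (f \in Der).
Proof.
apply: (iffP idP) => [|fD]; last first.
  rewrite /Der mem_bigcapv; apply/allP => x _.
  rewrite mem_bigcapv; apply/allP => y _.
  by rewrite memv_ker lfunE /= /leibniz_defect fD subrr.
rewrite /Der mem_bigcapv => /allP fD x y.
have fDb u v : u \in vbasis {:V} -> v \in vbasis {:V} ->
    f (br u v) = br (f u) v + br u (f v).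
  move=> /fD; rewrite mem_bigcapv => /allP + /[dup] vb => /(_ _ vb).
  by rewrite memv_ker lfunE /= subr_eq0 => /eqP.
have fDx v : v \in vbasis {:V} -> f (br x v) = br (f x) v + br x (f v).
  move=> vb; rewrite (coord_vbasis (memvf x)) linear_sum !linear_sumlz.
  rewrite linear_sum -big_split /=; apply: eq_bigr => i _.
  by rewrite linearZ !linearZl_LR linearZ /= fDb ?mem_nth ?size_tuple ?scalerDr.
rewrite (coord_vbasis (memvf y)) (linear_sum f) !linear_sumr.
rewrite linear_sum -big_split /=; apply: eq_bigr => i _.
rewrite !linearZr_LR !(linearZ_LR f) /= linearZr_LR.
by rewrite fDx ?mem_nth ?size_tuple // scalerDr.
Qed.

End Derivations.

(* Throughout, l = k + 1/2 with k : nat, so that 2l = 2k + 1.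
   [GM p] is M_{ij} for the pair p = (i, j), i < j; [GZ] is the central M. *)
Definition pairs (d : nat) := {p : 'I_d * 'I_d | (p.1 < p.2)%N}.

Variant gen (d k : nat) : Type :=
  | GD | GH | GC
  | GM of pairs d
  | GP of 'I_d & 'I_(k.*2.+2)
  | GZ.

Arguments GD {d k}.
Arguments GH {d k}.
Arguments GC {d k}.
Arguments GM {d k} p.
Arguments GP {d k} i n.
Arguments GZ {d k}.

Definition gen_code d k (a : gen d k) :
    'I_4 + (pairs d + 'I_d * 'I_(k.*2.+2)) :=
  match a with
  | GD => inl (inord 0) | GH => inl (inord 1) | GC => inl (inord 2)
  | GZ => inl (inord 3)
  | GM p => inr (inl p)
  | GP i n => inr (inr (i, n))
  end.

Definition gen_decode d k
    (c : 'I_4 + (pairs d + 'I_d * 'I_(k.*2.+2))) : gen d k :=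
  match c with
  | inl i => match val i with 0 => GD | 1 => GH | 2 => GC | _ => GZ end
  | inr (inl p) => GM p
  | inr (inr (i, n)) => GP i n
  end.

Lemma gen_codeK d k : cancel (@gen_code d k) (@gen_decode d k).
Proof. by case=> //=; rewrite inordK. Qed.

HB.instance Definition _ d k := Finite.copy (gen d k) (can_type (@gen_codeK d k)).

Section MassExtension.
Variables (R : realType) (d k : nat).
Implicit Types (a b : gen d k) (i j : 'I_d) (m n : nat).

Definition ghat : vectType R[i] := {ffun gen d k -> R[i]^o}.

Definition bas a : ghat := [ffun b => (b == a)%:R].

Definition lin_ext (v : gen d k -> ghat) : 'End(ghat) :=
  linfun (fun x : ghat => \sum_a x a *: v a).

Definition ell : R[i] := k%:R + 2^-1.

(* M_{ij} for all i and j: M_{ji} = - M_{ij} and M_{ii} = 0. *)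
Definition Mij i j : ghat :=
  if insub (i, j) is Some p then bas (GM p)
  else if insub (j, i) is Some p then - bas (GM p)
  else 0.

(* P_i^{(n)} for all n, with P_i^{(2l+1)} = 0. The value P_i^{(-1)} = 0 is
   not represented: it only occurs in [H, P_i^{(0)}], with coefficient 0. *)
Definition Pin i n : ghat :=
  if insub n is Some n' then bas (GP i n') else 0.

Definition Icoef m : R[i] :=
  (-1) ^+ (m + k + 1) * ((k.*2.+1 - m)`! * m`!)%:R.

Definition delta i j : R[i] := (i == j)%:R.

(* The non-zero brackets up to skew-symmetry; None stands for a pair that is
   absent from the list in this order. *)
Definition listed_bracket a b : option ghat :=
  match a, b with
  | GD, GH => Some (2 *: bas GH)
  | GD, GC => Some ((- 2) *: bas GC)
  | GC, GH => Some (bas GD)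
  | GM p, GM q =>
      let: (i, j) := val p in let: (r, s) := val q in
      Some (- delta i r *: Mij j s - delta j s *: Mij i r
            + delta i s *: Mij j r + delta j r *: Mij i s)
  | GH, GP i n => Some (- n%:R *: Pin i n.-1)
  | GD, GP i n => Some ((2 * (ell - n%:R)) *: Pin i n)
  | GC, GP i n => Some ((2 * ell - n%:R) *: Pin i n.+1)
  | GM p, GP r n =>
      let: (i, j) := val p in
      Some (- delta i r *: Pin j n + delta j r *: Pin i n)
  | GP i m, GP j n =>
      Some ((delta i j * (m + n == k.*2.+1)%N%:R * Icoef m) *: bas GZ)
  | _, _ => None
  end.

Definition bracket_gen a b : ghat :=
  if listed_bracket a b is Some v then v
  else if listed_bracket b a is Some v then - v
  else 0.

Definition bracket (x y : ghat) : ghat :=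
  \sum_a \sum_b (x a * y b) *: bracket_gen a b.

Definition deltaM : 'End(ghat) := lin_ext (fun a =>
  match a with
  | GP _ _ => bas a
  | GZ => 2 *: bas GZ
  | _ => 0
  end).

Lemma bracket_is_bilinear : bilinear_for *:%R *:%R bracket.
Proof.
split=> [y a u v|x a u v]; rewrite /= /bracket scaler_sumr -big_split /=;
  apply: eq_bigr => b _; rewrite scaler_sumr -big_split /=;
  apply: eq_bigr => c _; rewrite !ffunE scalerA -scalerDl; congr (_ *: _).
- by rewrite mulrDl mulrA.
- by rewrite mulrDr [X in X + _ = _]mulrCA.
Qed.
HB.instance Definition _ :=
  bilinear_isBilinear.Build R[i] ghat ghat ghat *:%R *:%R bracket
    bracket_is_bilinear.

Lemma bracketE a b : bracket (bas a) (bas b) = bracket_gen a b.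
Proof.
rewrite /bracket (bigD1 a) //= (bigD1 b) //= !ffunE !eqxx mulr1 scale1r.
rewrite !big1 ?addr0 // => [c /negPf ca|c /negPf cb].
  by rewrite big1 // => e _; rewrite !ffunE ca mul0r scale0r.
by rewrite !ffunE cb mulr0 scale0r.
Qed.

Lemma lin_extE v a : lin_ext v (bas a) = v a.
Proof.
have lin : linear (fun x : ghat => \sum_b x b *: v b).
  move=> c x y; rewrite scaler_sumr -big_split /=; apply: eq_bigr => b _.
  by rewrite !ffunE scalerDl scalerA.
pose F := GRing.isLinear.Build _ _ _ _ _ lin.
pose f : {linear ghat -> ghat} := HB.pack (fun x : ghat => \sum_b x b *: v b) F.
rewrite /lin_ext -[X in linfun X]/(f : ghat -> ghat) lfunE /= (bigD1 a) //=.
rewrite ffunE eqxx scale1r big1 ?addr0 // => b /negPf ba.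
by rewrite ffunE ba scale0r.
Qed.

End MassExtension.

(* s = - i M_{12}. *)
Definition s_gen (R : realType) (k : nat) : ghat R 2 k :=
  (- 'i%C) *: Mij R k ord0 ord_max.

(* eta_M(s) = M for s = - i M_{12} means eta_M(M_{12}) = i M; see etaM_s. *)
Definition etaM (R : realType) (k : nat) : 'End(ghat R 2 k) :=
  lin_ext (fun a =>
    match a with
    | GM _ => 'i%C *: bas R GZ
    | _ => 0
    end).

Lemma etaM_s (R : realType) (k : nat) : etaM R k (s_gen R k) = bas R GZ.
Proof.
rewrite /s_gen /Mij insubT /etaM linearZ /= lin_extE scalerA.
by rewrite mulNr -expr2 sqr_i opprK scale1r.
Qed.

(* Main.v *)
From HB Require Import structures.
Require Import Defs.
From mathcomp Require Import all_boot all_order all_algebra.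
From mathcomp Require Import complex reals.
From mathcomp Require Import zify ring.

Set Implicit Arguments.
Unset Strict Implicit.
Unset Printing Implicit Defensive.

Import Order.TTheory GRing.Theory Num.Theory.
Local Open Scope ring_scope.

(* A derivation f is corrected step by step until nothing is left.  An inner
   derivation removes the components of f D of nonzero weight; the Leibniz rule
   for [D, H], [D, C] and [C, H] then shows that f is a multiple of ad D on sl2,
   so one may assume that f kills sl2.  Such an f commutes with the action of
   sl2, hence acts on the P_i^(n) by a d x d matrix A that does not depend on n,
   and the brackets [P_i^(0), P_j^(2l)] give A + A^T = 2 lambda and
   f M = 2 lambda M.  After subtracting lambda delta_M and the inner derivation
   by the element of so(d) given by the antisymmetric matrix A - lambda, f kills
   everything except so(d).  As [f m, P] = f [m, P] - [m, f P] = 0 for m in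
   so(d), f maps so(d) into C M, and it vanishes on commutators.  For d <> 2
   this forces f = 0, as so(d) is perfect; for d = 2 it leaves the multiples of
   eta_M. *)

(** * The representation of sl2 on the P_i^(n) *)

Section OscillatorMatrices.
Variables (K : fieldType) (k : nat).
Local Notation N := (k.*2.+2).
Local Notation L := (k.*2.+1).

(** The eigenvalue [2(l - n)] of D on [P_i^(n)], written as [2l - 2n] to stay free of fractions. *)
Definition weight (n : nat) : K := L%:R - n.*2%:R.

(* The matrices of D, H and C acting on row vectors of coordinates along
   P_i^(0), ..., P_i^(2l), for a fixed i. *)
Definition TD : 'M[K]_N := \matrix_(m, n) ((n == m :> nat)%:R * weight m).
Definition TH : 'M[K]_N := \matrix_(m, n) ((m == n.+1 :> nat)%:R * - m%:R).
Definition TC : 'M[K]_N :=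
  \matrix_(m, n) ((n == m.+1 :> nat)%:R * (L%:R - m%:R)).

(** The coefficient [I_m] over any field, with [m + l + 1/2 = m + k + 1] as exponent. *)
Definition form_coef (m : nat) : K :=
  (-1) ^+ (m + k + 1) * ((L - m)`! * m`!)%:R.

(** The Gram matrix of the bracket on the [P_i^(n)] for a fixed i, in units of M. *)
Definition form_mx : 'M[K]_N :=
  \matrix_(m, n) ((m + n == L)%N%:R * form_coef m).

Lemma sum_pick n (F : nat -> K) (a : nat) : (a < n)%N ->
  \sum_(r < n) (r == a :> nat)%:R * F r = F a.
Proof.
move=> an; rewrite (bigD1 (Ordinal an)) //= eqxx mul1r big1 ?addr0 // => r ra.
by case: eqP => [e|_]; rewrite ?mul0r //; move: ra; rewrite -val_eqE /= e eqxx.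
Qed.

Lemma sum_pick0 n (F : nat -> K) (a : nat) : (n <= a)%N ->
  \sum_(r < n) (r == a :> nat)%:R * F r = 0.
Proof.
move=> na; apply: big1 => r _.
by rewrite ltn_eqF ?mul0r // (leq_trans (ltn_ord r)).
Qed.

Lemma mul_TD n (A : 'M[K]_(n, N)) i j : (A *m TD) i j = weight j * A i j.
Proof.
rewrite mxE (bigD1 j) //= big1 => [|r rj].
  by rewrite mxE eqxx mul1r addr0 mulrC.
by rewrite mxE eq_sym val_eqE (negPf rj) mul0r mulr0.
Qed.

Lemma mul_TDl n (A : 'M[K]_(N, n)) i j : (TD *m A) i j = weight i * A i j.
Proof.
rewrite mxE (bigD1 i) //= big1 => [|r rj].
  by rewrite mxE eqxx mul1r addr0.
by rewrite mxE val_eqE (negPf rj) mul0r mul0r.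
Qed.

Lemma mxaddE m n (A B : 'M[K]_(m, n)) i j : (A + B) i j = A i j + B i j.
Proof. by rewrite !mxE. Qed.

Lemma mxoppE m n (A : 'M[K]_(m, n)) i j : (- A) i j = - A i j.
Proof. by rewrite !mxE. Qed.

Lemma mxscaleE m n c (A : 'M[K]_(m, n)) i j : (c *: A) i j = c * A i j.
Proof. by rewrite !mxE. Qed.

(** The operators act on row vectors from the right, so [[D, H]] is represented by
    [TH *m TD - TD *m TH]; the same reversal occurs for the brackets with C. *)
Lemma TD_TH : TH *m TD - TD *m TH = 2 *: TH.
Proof.
apply/matrixP => m n; rewrite mxaddE mxoppE mul_TDl mul_TD !mxE /weight.
case: (m =P n.+1 :> nat) => [->|_]; last by rewrite !mul0r !mulr0 subrr.
by rewrite doubleS !mul1r; ring.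
Qed.

Lemma TD_TC : TC *m TD - TD *m TC = - 2 *: TC.
Proof.
apply/matrixP => m n; rewrite mxaddE mxoppE mul_TDl mul_TD !mxE /weight.
case: (n =P m.+1 :> nat) => [->|_]; last by rewrite !mul0r !mulr0 subrr.
by rewrite doubleS !mul1r; ring.
Qed.

Lemma mul_THl n (F : nat -> 'I_n -> K) i j :
  (TH *m \matrix_(r, s) F r s) i j = (0 < i)%N%:R * - (i%:R * F i.-1 j).
Proof.
rewrite mxE; under eq_bigr => r _ do rewrite !mxE -mulrA.
case: (posnP i) => [i0|i_gt0].
  by rewrite mul0r big1 // => r _; rewrite i0 mul0r.
under eq_bigr => r _ do rewrite -{1}(prednK i_gt0) eqSS eq_sym.
rewrite (sum_pick (fun r => - i%:R * F r j)); first by rewrite mul1r mulNr.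
by rewrite (leq_ltn_trans (leq_pred _)).
Qed.

Lemma mul_TCl n (F : nat -> 'I_n -> K) i j :
  (TC *m \matrix_(r, s) F r s) i j = (L%:R - i%:R) * F i.+1 j.
Proof.
rewrite mxE; under eq_bigr => r _ do rewrite !mxE -mulrA.
case: (ltnP i.+1 N) => [iN|Ni].
  by rewrite (sum_pick (fun r => (L%:R - i%:R) * F r j)).
rewrite (sum_pick0 (fun r => (L%:R - i%:R) * F r j)) //.
(* In the last row the missing successor is multiplied by [L - i = 0]. *)
have -> : val i = L by apply/eqP; rewrite eqn_leq -ltnS ltn_ord.
by rewrite subrr mul0r.
Qed.

Lemma TC_TH : TH *m TC - TC *m TH = TD.
Proof.
apply/matrixP => m n; rewrite mxaddE mxoppE.
rewrite (mul_THl (fun r (s : 'I_N) => (s == r.+1 :> nat)%:R * (L%:R - r%:R))).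
rewrite (mul_TCl (fun r (s : 'I_N) => (r == s.+1 :> nat)%:R * - r%:R)).
rewrite !mxE /weight -[m.*2]addnn natrD eqSS.
rewrite (eq_sym (m : nat) n).
case: (posnP m) => [->|m_gt0]; first by ring.
by rewrite prednK // -[m.-1]subn1 natrB // mul1r; ring.
Qed.

Lemma weightC m n : (m + n = L)%N -> weight n = - weight m.
Proof. by rewrite /weight => <-; rewrite -!addnn !natrD; ring. Qed.

(** Exchanging m and [2l - m] swaps the two factorials and flips the sign, because [n - m] has the
    parity of [m + n = 2l], which is odd. *)
Lemma form_coefC m n : (m + n = L)%N -> form_coef n = - form_coef m.
Proof.
wlog mn : m n / (m <= n)%N => [th mnL|mnL].
  case: (leqP m n) => [|/ltnW] mn; first exact: th.
  by rewrite (th n m) ?opprK // addnC.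
rewrite /form_coef (_ : (L - n)%N = m) 1?(_ : (L - m)%N = n); try lia.
rewrite mulnC -mulNr; congr (_ * _).
rewrite (_ : (n + k + 1 = m + k + 1 + (n - m))%N) ?exprD; last lia.
rewrite -[X in _ * X]signr_odd (_ : odd (n - m)) ?expr1 ?mulrN1 //; lia.
Qed.

(** Together with the sign rule above, this recursion is the invariance of the form under H and
    C. *)
Lemma form_coefS m : (m < L)%N ->
  (L%:R - m%:R) * form_coef m.+1 = - (m.+1%:R * form_coef m).
Proof.
move=> mL; rewrite /form_coef -natrB ?(ltnW mL) // !addSn exprS.
rewrite -(subnSK mL) !factS !natrM; ring.
Qed.

Lemma form_mx_tr : form_mx^T = - form_mx.
Proof.
apply/matrixP => m n; rewrite !mxE addnC.
case: eqP => [/form_coefC ->|_]; first by rewrite mulrN.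
by rewrite !mul0r oppr0.
Qed.

(** As [form_mx] is antisymmetric, invariance of the form under A reduces to the symmetry of
    [A *m form_mx]. *)
Lemma form_skew (A : 'M[K]_N) : (A *m form_mx)^T = A *m form_mx ->
  form_mx *m A^T = - (A *m form_mx).
Proof. by move=> <-; rewrite trmx_mul form_mx_tr mulNmx opprK. Qed.

Lemma form_TD : form_mx *m TD^T = - (TD *m form_mx).
Proof.
apply/form_skew/matrixP => m n; rewrite mxE !mul_TDl !mxE addnC.
case: eqP => [mnL|_]; last by rewrite !(mul0r, mulr0).
by rewrite (form_coefC mnL) (weightC mnL) !mul1r mulrNN.
Qed.

Lemma form_TH : form_mx *m TH^T = - (TH *m form_mx).
Proof.
apply/form_skew/matrixP => m n; rewrite mxE.
rewrite !(mul_THl (fun r (s : 'I_N) => (r + s == L)%N%:R * form_coef r)).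
have mN := ltn_ord m; have nN := ltn_ord n.
(* If just one of m and n is 0, one side vanishes by its leading factor and the other because the
   remaining indices sum to less than [2l]. *)
case: (posnP m) => [m0|m_gt0]; case: (posnP n) => [n0|n_gt0] /=.
- by rewrite m0 n0.
- by rewrite m0 (_ : (n.-1 + _ == _)%N = false) ?(mul0r, mulr0, oppr0) //; lia.
- by rewrite n0 (_ : (m.-1 + _ == _)%N = false) ?(mul0r, mulr0, oppr0) //; lia.
rewrite (_ : (m.-1 + n = n.-1 + m)%N); last lia.
case: eqP => [mnL|_]; last by rewrite !(mul0r, mulr0).
rewrite !mul1r (@form_coefC m n.-1); last by lia.
rewrite -{2}(prednK m_gt0) mulrN -[m in form_coef m](prednK m_gt0).
rewrite (_ : n%:R = L%:R - m.-1%:R); last by rewrite -natrB; [congr _%:R|]; lia.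
by rewrite form_coefS ?opprK //; lia.
Qed.

Lemma form_TC : form_mx *m TC^T = - (TC *m form_mx).
Proof.
apply/form_skew/matrixP => m n; rewrite mxE.
rewrite !(mul_TCl (fun r (s : 'I_N) => (r + s == L)%N%:R * form_coef r)).
rewrite (_ : (m.+1 + n = n.+1 + m)%N); last lia.
case: eqP => [mnL|_]; last by rewrite !(mul0r, mulr0).
rewrite !mul1r (@form_coefS m); last by lia.
rewrite (@form_coefC m n.+1); last by lia.
by rewrite mulrN (_ : L%:R - n%:R = m.+1%:R) // -natrB; [congr _%:R|]; lia.
Qed.

End OscillatorMatrices.

(** * Derivations in coordinates *)

(* x = cD x D + cH x H + cC x C + cZ x M plus a component in so(d), given by the
   antisymmetric matrix cS x, and one along the P_i^(n), given by cP x.  V is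
   kept abstract to keep unification from unfolding R[i] and ghat. *)
Record mass_coords (K : fieldType) (d k : nat) (V : vectType K)
    (br : {bilinear V -> V -> V}) := MassCoords {
  cD : V -> K; cH : V -> K; cC : V -> K; cZ : V -> K;
  cS : V -> 'M[K]_d;
  cP : V -> 'M[K]_(d, k.*2.+2);
  cD_scalar : scalar cD; cH_scalar : scalar cH;
  cC_scalar : scalar cC; cZ_scalar : scalar cZ;
  cS_linear : linear cS; cP_linear : linear cP;
  mk : K -> K -> K -> K -> 'M[K]_d -> 'M[K]_(d, k.*2.+2) -> V;
  cS_tr : forall x, (cS x)^T = - cS x;
  mkD : forall a b c z s p, cD (mk a b c z s p) = a;
  mkH : forall a b c z s p, cH (mk a b c z s p) = b;
  mkC : forall a b c z s p, cC (mk a b c z s p) = c;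
  mkZ : forall a b c z s p, cZ (mk a b c z s p) = z;
  mkS : forall a b c z s p, s^T = - s -> cS (mk a b c z s p) = s;
  mkP : forall a b c z s p, cP (mk a b c z s p) = p;
  coordsP : forall x y, cD x = cD y -> cH x = cH y -> cC x = cC y ->
    cZ x = cZ y -> cS x = cS y -> cP x = cP y -> x = y;
  brD : forall x y, cD (br x y) = cC x * cH y - cH x * cC y;
  brH : forall x y, cH (br x y) = 2 * (cD x * cH y - cH x * cD y);
  brC : forall x y, cC (br x y) = - 2 * (cD x * cC y - cC x * cD y);
  brZ : forall x y, cZ (br x y) = \tr (cP x *m form_mx K k *m (cP y)^T);
  brS : forall x y, cS (br x y) = cS x *m cS y - cS y *m cS x;
  brP : forall x y, cP (br x y) = cS x *m cP y - cS y *m cP x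
    + cP y *m (cD x *: TD K k + cH x *: TH K k + cC x *: TC K k)
    - cP x *m (cD y *: TD K k + cH y *: TH K k + cC y *: TC K k)
}.

HB.instance Definition _ K d k V br (X : @mass_coords K d k V br) :=
  GRing.isLinear.Build K V K _ (cD X) (cD_scalar X).
HB.instance Definition _ K d k V br (X : @mass_coords K d k V br) :=
  GRing.isLinear.Build K V K _ (cH X) (cH_scalar X).
HB.instance Definition _ K d k V br (X : @mass_coords K d k V br) :=
  GRing.isLinear.Build K V K _ (cC X) (cC_scalar X).
HB.instance Definition _ K d k V br (X : @mass_coords K d k V br) :=
  GRing.isLinear.Build K V K _ (cZ X) (cZ_scalar X).
HB.instance Definition _ K d k V br (X : @mass_coords K d k V br) :=
  GRing.isLinear.Build K V _ _ (cS X) (cS_linear X).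
HB.instance Definition _ K d k V br (X : @mass_coords K d k V br) :=
  GRing.isLinear.Build K V _ _ (cP X) (cP_linear X).

(** The P component of the Jacobi identity, with so(d) acting on the left and sl2 on the right. It
    is formal: by associativity, both sides expand into the same monomials. *)
Lemma semidirect_jacobi (K : fieldType) d n (A B C : 'M[K]_d)
    (T U W : 'M[K]_n) (p q r : 'M[K]_(d, n)) :
   A *m (B *m r - C *m q + r *m U - q *m W) - (B *m C - C *m B) *m p
  + (B *m r - C *m q + r *m U - q *m W) *m T - p *m (W *m U - U *m W) =
   ((A *m B - B *m A) *m r - C *m (A *m q - B *m p + q *m T - p *m U)
  + r *m (U *m T - T *m U) - (A *m q - B *m p + q *m T - p *m U) *m W) +
   (B *m (A *m r - C *m p + r *m T - p *m W) - (A *m C - C *m A) *m q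
  + (A *m r - C *m p + r *m T - p *m W) *m U - q *m (W *m T - T *m W)).
Proof.
rewrite !(mulmxDl, mulmxDr, mulNmx, mulmxN) !mulmxA.
by apply/matrixP => i j; rewrite !(mxaddE, mxoppE); ring.
Qed.

Section Derivations.
Variables (K : fieldType) (d k : nat) (V : vectType K).
Variables (br : {bilinear V -> V -> V}) (X : mass_coords d k br).
Hypothesis charK : [pchar K] =i pred0.
Local Notation N := (k.*2.+2).
Local Notation L := (k.*2.+1).
Local Notation cD := (cD X).
Local Notation cH := (cH X).
Local Notation cC := (cC X).
Local Notation cZ := (cZ X).
Local Notation cS := (cS X).
Local Notation cP := (cP X).
Local Notation mk := (mk X).
Local Notation TD := (TD K k).
Local Notation TH := (TH K k).
Local Notation TC := (TC K k).
Local Notation J := (form_mx K k).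

(** * The Lie algebra axioms, derived from the coordinate formulas *)

Definition sl_mx x : 'M[K]_N := cD x *: TD + cH x *: TH + cC x *: TC.

(** The alternating form obtained from [J] on each of the d copies of the sl2-module; so(d) and sl2
    act on it by skew operators. *)
Definition omega (p q : 'M[K]_(d, N)) : K := \tr (p *m J *m q^T).

Lemma brP_sl x y : cP (br x y) =
  cS x *m cP y - cS y *m cP x + cP y *m sl_mx x - cP x *m sl_mx y.
Proof. exact: brP. Qed.

Lemma brZ_omega x y : cZ (br x y) = omega (cP x) (cP y).
Proof. exact: brZ. Qed.

Lemma sl_mx_br x y : sl_mx (br x y) = sl_mx y *m sl_mx x - sl_mx x *m sl_mx y.
Proof.
rewrite /sl_mx brD brH brC.
rewrite !(mulmxDl, mulmxDr) -!(scalemxAl, scalemxAr).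
(* The relations become rules that replace [TH *m TD], [TC *m TD] and [TH *m TC] by the opposite
   product plus a correction, so that all products get one fixed order. *)
have /(canRL (subrK _)) -> := TD_TH K k.
have /(canRL (subrK _)) -> := TD_TC K k.
have /(canRL (subrK _)) -> := TC_TH K k.
apply/matrixP => i j; rewrite !(mxaddE, mxoppE, mxscaleE). ring.
Qed.

Lemma omegaBr p q r : omega p (q - r) = omega p q - omega p r.
Proof. by rewrite /omega linearB /= mulmxBr linearB. Qed.
Lemma omegaDr p q r : omega p (q + r) = omega p q + omega p r.
Proof. by rewrite /omega linearD /= mulmxDr linearD. Qed.
Lemma omegaBl p q r : omega (q - r) p = omega q p - omega r p.
Proof. by rewrite /omega !mulmxBl linearB. Qed.
Lemma omegaDl p q r : omega (q + r) p = omega q p + omega r p.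
Proof. by rewrite /omega !mulmxDl linearD. Qed.

Lemma omegaC p q : omega q p = - omega p q.
Proof.
rewrite /omega -mxtrace_tr !trmx_mul trmxK form_mx_tr.
by rewrite mulNmx mulmxN mulmxA linearN.
Qed.

Lemma omega_mulr (A : 'M[K]_d) p q : omega p (A *m q) = omega (A^T *m p) q.
Proof. by rewrite /omega trmx_mul !mulmxA mxtrace_mulC !mulmxA. Qed.

Lemma omega_so x p q : omega p (cS x *m q) = - omega (cS x *m p) q.
Proof. by rewrite omega_mulr cS_tr /omega !mulNmx linearN. Qed.

Lemma form_sl x : J *m (sl_mx x)^T = - (sl_mx x *m J).
Proof.
rewrite /sl_mx !linearD !linearZ /= form_TD form_TH form_TC !scalerN -!opprD.
by rewrite !mulmxDl !scalemxAl.
Qed.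

Lemma omega_sl x p q : omega p (q *m sl_mx x) = - omega (p *m sl_mx x) q.
Proof.
rewrite /omega trmx_mul mulmxA -(mulmxA p J) form_sl.
by rewrite mulmxN mulNmx linearN !mulmxA.
Qed.

Lemma br_anti x y : br y x = - br x y.
Proof.
apply: (coordsP (m := X)); rewrite linearN /=;
  try by (rewrite !(brD, brH, brC); ring).
- by rewrite !brZ_omega omegaC.
- by rewrite !brS opprB.
- by rewrite !brP_sl !opprD !opprK [RHS](ACl (2*1*4*3))%AC.
Qed.

Lemma jacobi x y z : br x (br y z) = br (br x y) z + br y (br x z).
Proof.
apply: (coordsP (m := X)); rewrite linearD /=;
  try by (rewrite !(brD, brH, brC); ring).
(* The M component: so(d) and sl2 are skew for [omega], so their contributions agree. *)
- rewrite !brZ_omega !brP_sl.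
  rewrite !(omegaBl, omegaBr, omegaDl, omegaDr) !omega_so !omega_sl.
  rewrite [omega (cS z *m cP y) _]omegaC [omega (cP y *m sl_mx z) _]omegaC.
  by rewrite omega_so omega_sl; ring.
- rewrite !brS !(mulmxDl, mulmxDr, mulNmx, mulmxN) !mulmxA.
  by apply/matrixP => i j; rewrite !(mxaddE, mxoppE); ring.
- by rewrite !brP_sl !sl_mx_br !brS semidirect_jacobi.
Qed.

Lemma natK_neq0 n : (n.+1%:R != 0 :> K).
Proof. by rewrite ((pcharf0P K).1 charK). Qed.

Lemma Inn_Der : (Inn br <= Der br)%VS.
Proof.
apply/subvP => f /InnP[x fE]; apply/DerP => y z.
by rewrite !fE jacobi.
Qed.

(** * Generators and their brackets *)

Local Notation gD := (mk 1 0 0 0 0 0).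
Local Notation gH := (mk 0 1 0 0 0 0).
Local Notation gC := (mk 0 0 1 0 0 0).
Local Notation gZ := (mk 0 0 0 1 0 0).
Local Notation gM s := (mk 0 0 0 0 s 0).
Local Notation gP p := (mk 0 0 0 0 0 p).

Lemma mkS0 a b c z p : cS (mk a b c z 0 p) = 0.
Proof. by rewrite mkS // trmx0 oppr0. Qed.

Definition mkE := (mkD X, mkH X, mkC X, mkZ X, mkS0, mkP X).

Lemma omega0l p : omega 0 p = 0.
Proof. by rewrite /omega !mul0mx linear0. Qed.
Lemma omega0r p : omega p 0 = 0.
Proof. by rewrite /omega trmx0 mulmx0 linear0. Qed.

Lemma sl_mx_mk a b c z s p :
  sl_mx (mk a b c z s p) = a *: TD + b *: TH + c *: TC.
Proof. by rewrite /sl_mx mkD mkH mkC. Qed.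

Ltac simplify_units := rewrite
  ?(mul0r, mulr0, mul0mx, mulmx0, addr0, add0r, subr0, sub0r, oppr0,
    scale0r, scale1r, mul1r, mulr1, omega0l, omega0r, scaler0) //.

Ltac coordinatewise := apply: (coordsP (m := X));
  rewrite ?linearD ?linearZ ?linear0 /= ?mkE; simplify_units.

Ltac bracket_coordinatewise := apply: (coordsP (m := X));
  [rewrite brD|rewrite brH|rewrite brC|rewrite brZ_omega|rewrite brS
  |rewrite brP_sl ?sl_mx_mk];
  rewrite ?mkE ?linearZ ?linear0 /= ?mkE; simplify_units.

Lemma mk0 : mk 0 0 0 0 0 0 = 0.
Proof. by coordinatewise. Qed.

Lemma gZ_scale c : mk 0 0 0 c 0 0 = c *: gZ.
Proof. by coordinatewise. Qed.

Lemma mk_decomp x : x = cD x *: gD + cH x *: gH + cC x *: gC + cZ x *: gZ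
  + gM (cS x) + gP (cP x).
Proof. by coordinatewise; rewrite mkS ?cS_tr. Qed.

Lemma br_C_H : br gC gH = gD.
Proof. by bracket_coordinatewise. Qed.

Lemma br_D_D : br gD gD = 0.
Proof. by bracket_coordinatewise. Qed.

Lemma br_D_H : br gD gH = 2 *: gH.
Proof. by bracket_coordinatewise. Qed.

Lemma br_D_C : br gD gC = - 2 *: gC.
Proof. by bracket_coordinatewise. Qed.

Lemma br_D_P p : br gD (gP p) = gP (p *m TD).
Proof. by bracket_coordinatewise. Qed.

Lemma br_C_P p : br gC (gP p) = gP (p *m TC).
Proof. by bracket_coordinatewise. Qed.

Lemma br_P_P p q : br (gP p) (gP q) = omega p q *: gZ.
Proof. by bracket_coordinatewise. Qed.

Lemma br_M_P s p : s^T = - s -> br (gM s) (gP p) = gP (s *m p).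
Proof. by move=> sT; bracket_coordinatewise; rewrite mkS ?mul0mx ?subr0. Qed.

Lemma br_sl_M s a b c : s^T = - s -> br (mk a b c 0 0 0) (gM s) = 0.
Proof. by move=> sT; bracket_coordinatewise. Qed.

Lemma br_M_M s t : s^T = - s -> t^T = - t ->
  br (gM s) (gM t) = gM (s *m t - t *m s).
Proof.
move=> sT tT; bracket_coordinatewise.
by rewrite !mkS // linearB /= !trmx_mul sT tT !mulNmx !mulmxN !opprK opprB.
Qed.

Lemma br_Z x : br x gZ = 0.
Proof. by bracket_coordinatewise. Qed.

Lemma br_Z_l x : br gZ x = 0.
Proof. by bracket_coordinatewise. Qed.

Lemma gPZD a p q : gP (a *: p + q) = a *: gP p + gP q.
Proof. by coordinatewise. Qed.

Lemma gP_is_linear : linear (fun p => gP p).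
Proof. exact: gPZD. Qed.

Lemma gZ_neq0 : gZ != 0.
Proof.
by apply/eqP => /(congr1 cZ); rewrite linear0 mkZ => /eqP; rewrite oner_eq0.
Qed.

(** * Separation of the weights of ad D *)

Lemma natK_eq (a b : nat) : (a%:R == b%:R :> K) = (a == b).
Proof.
wlog ab : a b / (a <= b)%N => [th|].
  by case: (leqP a b) => [|/ltnW] /th // e; rewrite eq_sym e eq_sym.
rewrite eq_sym -subr_eq0 -natrB // ((pcharf0P K).1 charK).
by rewrite subn_eq0 eqn_leq ab.
Qed.

(* 2l is odd, so the weights of the P_i^(n) are odd and differ from those of
   D, H and C. *)
Lemma odd_natK_neq (a b : nat) : odd a -> ~~ odd b -> (a%:R != b%:R :> K).
Proof. by move=> oa ob; rewrite natK_eq; apply: contraNneq ob => <-. Qed.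

Lemma weight_neq0 n : weight K k n != 0.
Proof. by rewrite subr_eq0 odd_natK_neq //= odd_double. Qed.

Lemma weight_neq2 n : weight K k n != 2.
Proof.
rewrite -subr_eq0 -[_ - _]addrA -opprD subr_eq0 -natrD odd_natK_neq //=;
by rewrite ?oddD ?odd_double.
Qed.

Lemma weight_neqN2 n : weight K k n != - 2.
Proof.
rewrite -subr_eq0 opprK addrAC subr_eq0 -natrD odd_natK_neq //=;
by rewrite ?oddD ?odd_double.
Qed.

Lemma adE x y : ad br x y = br x y.
Proof. by rewrite lfunE. Qed.

Lemma ad_Der x : ad br x \in Der br.
Proof. by apply: (subvP Inn_Der); apply/InnP; exists x => y; rewrite adE. Qed.

(** * Reduction to derivations that kill sl2 *)

Lemma derivation_weight0 f : f \in Der br -> exists z,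
  let x := (f - ad br z) gD in [/\ cH x = 0, cC x = 0 & cP x = 0].
Proof.
move=> _; have n2 := natK_neq0 1.
(* H, C and [P_i^(n)] are eigenvectors of ad D with nonzero eigenvalues 2, -2 and [weight K k n].
   The components of [f gD] are divided by these, with a minus sign because [[z, D] = - [D, z]]. *)
exists (mk 0 (- (cH (f gD) / 2)) (cC (f gD) / 2) 0 0
  (\matrix_(i, n) - (cP (f gD) i n / weight K k n))).
rewrite /= add_lfunE opp_lfunE adE !linearB /= brH brC brP_sl !sl_mx_mk.
rewrite !(mkD, mkH, mkC, mkS0, mkP).
split; try by field.
rewrite !(mul0mx, mulmx0, scale0r, scale1r, addr0, sub0r, opprK, oppr0).
apply/matrixP => i n; rewrite mxaddE mul_TD !mxE.
by field; exact: weight_neq0.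
Qed.

(** Here [f gD] has components along D, so(d) and M only. The Leibniz rule then makes [f gH] and
    [f gC] eigenvectors of ad D for 2 and -2, weights carried by H and C alone since those of the
    [P_i^(n)] are odd. *)
Lemma derivation_sl_diag f : f \in Der br ->
  cH (f gD) = 0 -> cC (f gD) = 0 -> cP (f gD) = 0 ->
  exists h, [/\ f gD = 0, f gH = h *: gH & f gC = - h *: gC].
Proof.
move=> /DerP fD xH xC xP; have n2 := natK_neq0 1.
have scal_eq0 (a b : K) : a != 0 -> a * b = 0 -> b = 0.
  by move=> a0 /eqP; rewrite mulf_eq0 (negPf a0) => /eqP.
have mx_eq0 (a : K) (s : 'M[K]_d) : a != 0 -> a *: s = 0 -> s = 0.
  by move=> a0 /eqP; rewrite scalemx_eq0 (negPf a0) => /eqP.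
have eH := fD gD gH; rewrite br_D_H linearZ /= in eH.
(* In the H component of the Leibniz rule for [[D, H]] the term [2 * cH (f gH)] occurs on both
   sides, which leaves [2 * cD (f gD) = 0]. *)
have xD : cD (f gD) = 0.
  have := congr1 cH eH; rewrite linearD linearZ /= !brH !(mkD, mkH).
  rewrite xH !(mul1r, mulr1, mul0r, subr0) => /eqP.
  rewrite -subr_eq0 opprD addrCA subrr addr0 oppr_eq0.
  by rewrite mulf_eq0 (negPf n2) => /eqP.
have fH : f gH = cH (f gH) *: gH.
  coordinatewise.
  - have := congr1 cD eH; rewrite linearD linearZ /= !brD !(mkC, mkH) xC xH.
    rewrite !(mul0r, mulr0, subr0, addr0); exact: scal_eq0.
  - have := congr1 cC eH; rewrite linearD linearZ /= !brC !(mkC, mkH, mkD) xC.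
    rewrite !(mul0r, mulr0, subr0, add0r, oppr0, mul1r) => /eqP.
    rewrite -subr_eq0. rewrite mulNr opprK -mulrDl => /eqP; apply: scal_eq0.
    by rewrite -natrD natK_neq0.
  - have := congr1 cZ eH; rewrite linearD linearZ /= !brZ_omega !mkP.
    rewrite omega0l omega0r addr0; exact: scal_eq0.
  - have := congr1 cS eH; rewrite linearD linearZ /= !brS !mkS0.
    rewrite !(mul0mx, mulmx0, subr0, addr0); exact: mx_eq0.
  - have := congr1 cP eH; rewrite linearD linearZ /= !brP_sl.
    rewrite !(mkS0, mkP) xP !sl_mx_mk.
    rewrite !(mul0mx, mulmx0, subr0, addr0, oppr0, add0r, scale1r, scale0r).
    move=> /matrixP e.
    apply/matrixP => i n; have /eqP := e i n.
    rewrite mxscaleE mul_TD mxE.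
    rewrite -subr_eq0 -mulrBl mulf_eq0 subr_eq0 eq_sym (negPf (weight_neq2 n)).
    by move=> /eqP.
have eC := fD gD gC; rewrite br_D_C linearZ /= in eC.
have fC : f gC = cC (f gC) *: gC.
  coordinatewise.
  - have := congr1 cD eC; rewrite linearD linearZ /= !brD !(mkC, mkH) xC xH.
    rewrite !(mul0r, mulr0, subr0, addr0); by apply: scal_eq0; rewrite oppr_eq0.
  - have := congr1 cH eC; rewrite linearD linearZ /= !brH !(mkC, mkH, mkD) xH.
    rewrite !(mul0r, mulr0, subr0, add0r, oppr0, mul1r) => /eqP.
    rewrite -subr_eq0 mulNr -opprD -mulrDl oppr_eq0 => /eqP; apply: scal_eq0.
    by rewrite -natrD natK_neq0.
  - have := congr1 cZ eC; rewrite linearD linearZ /= !brZ_omega !mkP.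
    rewrite omega0l omega0r addr0; by apply: scal_eq0; rewrite oppr_eq0.
  - have := congr1 cS eC; rewrite linearD linearZ /= !brS !mkS0.
    rewrite !(mul0mx, mulmx0, subr0, addr0); by apply: mx_eq0; rewrite oppr_eq0.
  - have := congr1 cP eC; rewrite linearD linearZ /= !brP_sl.
    rewrite !(mkS0, mkP) xP !sl_mx_mk.
    rewrite !(mul0mx, mulmx0, subr0, addr0, oppr0, add0r, scale1r, scale0r).
    move=> /matrixP e.
    apply/matrixP => i n; have /eqP := e i n.
    rewrite mxscaleE mul_TD mxE.
    rewrite -subr_eq0 -mulrBl mulf_eq0 subr_eq0 eq_sym (negPf (weight_neqN2 n)).
    by move=> /eqP.
(* By [D = [C, H]], [f gD] is a multiple of D; its D component is already 0, so the coefficients on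
   C and H are opposite. *)
have fgD : f gD = (cC (f gC) + cH (f gH)) *: gD.
  rewrite -[in LHS]br_C_H fD [X in br X gH]fC [X in _ + br _ X]fH.
  by rewrite linearZl_LR linearZr_LR /= br_C_H -scalerDl.
have ch : cC (f gC) + cH (f gH) = 0.
  by have := congr1 cD fgD; rewrite xD linearZ /= mkD mulr1.
exists (cH (f gH)); split=> //; first by rewrite fgD ch scale0r.
by rewrite [LHS]fC; congr (_ *: _); apply/eqP; rewrite -addr_eq0 ch eqxx.
Qed.

Lemma derivation_kills_sl f : f \in Der br -> exists z,
  let g := f - ad br z in [/\ g \in Der br, g gD = 0, g gH = 0 & g gC = 0].
Proof.
move=> fD; have [z [xH xC xP]] := derivation_weight0 fD.
have gDer : f - ad br z \in Der br by rewrite rpredB ?ad_Der.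
have [h [gD0 gH0 gC0]] := derivation_sl_diag gDer xH xC xP.
have n2 := natK_neq0 1.
(* ad D multiplies H by 2 and C by -2, so [h / 2] times ad D accounts for the remaining factors h
   and -h. *)
exists (z + (h / 2) *: gD).
have E u : (f - ad br (z + h / 2 *: gD)) u =
    (f - ad br z) u - (h / 2) *: br gD u.
  by rewrite !add_lfunE !opp_lfunE !adE linearDl linearZl_LR opprD addrA.
split; first by rewrite rpredB ?ad_Der.
- by rewrite E gD0 br_D_D scaler0 subr0.
- by rewrite E gH0 br_D_H scalerA -scalerBl mulfVK // subrr scale0r.
- rewrite E gC0 br_D_C scalerA -scalerBl mulrN mulfVK // opprK addrC subrr.
  by rewrite scale0r.
Qed.

(** * The action on the [P_i^(n)] and on M *)

Lemma mul_mx_deltaE m n p (A : 'M[K]_(m, n)) i (j : 'I_p) a b :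
  (A *m delta_mx i j) a b = A a i * (b == j)%:R.
Proof.
rewrite mxE (bigD1 i) //= mxE eqxx big1 ?addr0 // => r ri.
by rewrite mxE (negPf ri) mulr0.
Qed.

Lemma mul_delta_mxE m n p (A : 'M[K]_(n, p)) (i : 'I_m) j a b :
  (delta_mx i j *m A) a b = (a == i)%:R * A j b.
Proof.
rewrite mxE (bigD1 j) //= mxE eqxx andbT big1 ?addr0 // => r rj.
by rewrite mxE (negPf rj) andbF mul0r.
Qed.

Lemma gP_expand p :
  gP p = \sum_i \sum_n p i n *: gP (delta_mx i n).
Proof.
pose F : {linear 'M_(d, N) -> V} :=
  HB.pack (fun p => gP p) (GRing.isLinear.Build _ _ _ _ _ gP_is_linear).
rewrite -[gP p]/(F p) {1}(matrix_sum_delta p) linear_sum.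
apply: eq_bigr => i _; rewrite linear_sum; apply: eq_bigr => n _.
by rewrite linearZ.
Qed.

Lemma omega_delta (A : 'M[K]_d) i m j n :
  omega (A *m delta_mx i m) (delta_mx j n) = A j i * J m n.
Proof.
rewrite /omega trmx_delta /mxtrace (bigD1 j) //= big1 => [|r rj].
  rewrite mul_mx_deltaE eqxx mulr1 addr0 mxE (bigD1 m) //= big1 => [|r rm].
    by rewrite mul_mx_deltaE eqxx mulr1 addr0.
  by rewrite mul_mx_deltaE (negPf rm) mulr0 mul0r.
by rewrite mul_mx_deltaE (negPf rj) mulr0.
Qed.

(** Since [f gD = 0], f commutes with ad D and the image of [P_i^(0)] keeps the weight 2l, which is
    odd and, among the [P_j^(n)], occurs only for n = 0. *)
Lemma derivation_P0 f i : f \in Der br -> f gD = 0 ->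
  let y := f (gP (delta_mx i ord0)) in
  y = gP (\matrix_(j, n) (cP y j ord0 * (n == ord0)%:R)).
Proof.
move=> /DerP fD fgD y; have n2 := natK_neq0 1.
have ey : weight K k 0 *: y = br gD y.
  have := fD gD (gP (delta_mx i ord0)); rewrite br_D_P fgD linear0l add0r => <-.
  rewrite -linearZ; congr (f _); coordinatewise; apply/matrixP => a b.
  rewrite mxscaleE mul_TD !mxE; case: (b =P ord0) => [->|_] //.
  by rewrite andbF !mulr0.
have scal_eq0 (a b c : K) : a * b = c * b -> a != c -> b = 0.
  by move=> /eqP; rewrite -subr_eq0 -mulrBl mulf_eq0 subr_eq0 => /orP[->|/eqP].
have w0 := weight_neq0 0.
coordinatewise.
- have := congr1 cD ey; rewrite linearZ /= brD !mkE => e.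
  by apply: scal_eq0 w0; rewrite e; ring.
- have := congr1 cH ey; rewrite linearZ /= brH !mkE => e.
  by apply: scal_eq0 (weight_neq2 0); rewrite e; ring.
- have := congr1 cC ey; rewrite linearZ /= brC !mkE => e.
  by apply: scal_eq0 (weight_neqN2 0); rewrite e; ring.
- have := congr1 cZ ey; rewrite linearZ /= brZ_omega !mkE omega0l => e.
  by apply: scal_eq0 w0; rewrite e mul0r.
- have := congr1 cS ey; rewrite linearZ /= brS !mkE mul0mx mulmx0 subr0 => /eqP.
  by rewrite scalemx_eq0 (negPf w0) => /eqP.
have := congr1 cP ey; rewrite linearZ /= brP_sl !mkE sl_mx_mk.
rewrite !(mul0mx, mulmx0, subr0, addr0, oppr0, add0r, scale1r, scale0r).
move=> /matrixP e.
apply/matrixP => j n; have := e j n; rewrite mxscaleE mul_TD !mxE.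
case: (n =P ord0) => [-> _|/eqP n0 /scal_eq0->]; first by rewrite mulr1.
  by rewrite mulr0.
rewrite /weight double0 subr0 eq_sym subr_eq -natrD natK_eq.
by rewrite -[X in X == _]addn0 eqn_add2l eq_sym double_eq0.
Qed.

(** f also commutes with ad C, and [[C, P_i^(m)]] is [P_i^(m+1)] times [2l - m], which is nonzero
    for m < 2l. Hence the matrix found on the [P_i^(0)] propagates to every n. *)
Lemma derivation_P f : f \in Der br -> f gD = 0 -> f gC = 0 ->
  exists A : 'M[K]_d, forall p, f (gP p) = gP (A *m p).
Proof.
move=> fDer fgD fgC; have /DerP fD := fDer.
(* Column i holds the coordinates of the image of [P_i^(0)]. *)
pose A := \matrix_(j, i) cP (f (gP (delta_mx i ord0))) j ord0 : 'M[K]_d.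
have fA m i : (m < N)%N ->
    f (gP (delta_mx i (inord m))) = gP (A *m delta_mx i (inord m)).
  elim: m => [_|m IHm mN].
    have -> : inord 0 = ord0 :> 'I_N by apply/val_inj; rewrite /= inordK.
    rewrite (derivation_P0 i fDer fgD); congr (mk 0 0 0 0 0 _).
    apply/matrixP => a b.
    by rewrite mul_mx_deltaE !mxE.
  have mN' := ltnW mN.
  have dTC : delta_mx i (inord m) *m TC
      = (L%:R - m%:R) *: (delta_mx i (inord m.+1) : 'M[K]_(d, N)).
    apply/matrixP => a b; rewrite mul_delta_mxE !mxE inordK //.
    have -> : (b == inord m.+1) = (b == m.+1 :> nat).
      by rewrite -val_eqE /= inordK.
    by rewrite -mulnb natrM; ring.
  have := fD gC (gP (delta_mx i (inord m))).
  rewrite br_C_P fgC linear0l add0r IHm // br_C_P -mulmxA dTC.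
  have Lm : L%:R - m%:R != 0 :> K.
    by rewrite subr_eq0 natK_eq gtn_eqF.
  have gPZ a p : gP (a *: p) = a *: gP p.
    by rewrite -[a *: p]addr0 gPZD mk0 addr0.
  by rewrite -scalemxAr !gPZ linearZ /= => /(scalerI Lm).
exists A => p; rewrite [in LHS]gP_expand linear_sum /=.
pose F : {linear 'M_(d, N) -> V} :=
  HB.pack (fun p => gP p) (GRing.isLinear.Build _ _ _ _ _ gP_is_linear).
rewrite -[RHS]/(F _) [p in RHS]matrix_sum_delta mulmx_sumr linear_sum.
apply: eq_bigr => i _; rewrite mulmx_sumr !linear_sum; apply: eq_bigr => n _.
have fn := fA n i (ltn_ord n); rewrite inord_val in fn.
by rewrite -scalemxAr !linearZ /= fn.
Qed.

Lemma derivation_Z f (A : 'M[K]_d) : f \in Der br ->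
  (forall p, f (gP p) = gP (A *m p)) -> (0 < d)%N ->
  exists lambda, f gZ = (2 * lambda) *: gZ /\
    (A - lambda%:M)^T = - (A - lambda%:M).
Proof.
move=> /DerP fD fP d_gt0.
(* This entry is [I_0], a sign times (2l)!, nonzero in characteristic 0. *)
have J_neq0 : J ord0 ord_max != 0.
  rewrite mxE eqxx mul1r mulf_eq0 signr_eq0 ((pcharf0P K).1 charK).
  by rewrite -lt0n muln_gt0 !fact_gt0.
(* The Leibniz rule for [[P_i^(0), P_j^(2l)]], divided by [I_0]. *)
have fZ i j : (i == j)%:R *: f gZ = (A j i + A i j) *: gZ.
  apply: (scalerI J_neq0).
  have := fD (gP (delta_mx i ord0)) (gP (delta_mx j ord_max)).
  rewrite !fP !br_P_P linearZ /= -scalerDl omega_mulr !omega_delta.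
  rewrite -[delta_mx i ord0]mul1mx omega_delta; move: (J ord0 ord_max) => j0.
  rewrite !mxE eq_sym !scalerA mulrDr ![j0 * _]mulrC; exact.
(* The case i = j reads [f M = 2 A_ii M], so all diagonal entries agree and any one of them can
   serve as lambda. *)
pose i0 := Ordinal d_gt0; exists (A i0 i0); split.
  by have := fZ i0 i0; rewrite eqxx scale1r mulr_natl mulr2n.
apply/matrixP => i j; rewrite !mxE [j == i]eq_sym.
have := fZ i j; have /(congr1 cZ) := fZ i0 i0.
rewrite eqxx scale1r linearZ /= mkE mulr1 => e /(congr1 cZ).
rewrite !linearZ /= mkE mulr1 e => {}e.
have -> : A j i = (i == j)%:R * (A i0 i0 + A i0 i0) - A i j by rewrite e addrK.
by rewrite -mulr_natl; ring.
Qed.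

Lemma derivation_normal_form (delta : 'End(V)) f :
  (forall x, delta x = mk 0 0 0 (2 * cZ x) 0 (cP x)) -> delta \in Der br ->
  f \in Der br -> (0 < d)%N ->
  exists z lambda, let g := f - ad br z - lambda *: delta in
    g \in Der br /\ forall x, cS x = 0 -> g x = 0.
Proof.
move=> deltaE deltaD fDer d_gt0.
have [z [gDer gD0 gH0 gC0]] := derivation_kills_sl fDer.
have [A gA] := derivation_P gDer gD0 gC0.
have [lambda [gZ0 sT]] := derivation_Z gDer gA d_gt0.
set s := A - lambda%:M in sT.
(* On the P part [ad br (gM s)] acts by [s = A - lambda] and [delta] by 1, which recovers A; on M
   they act by 0 and 2, which recovers [2 * lambda]. *)
exists (z + gM s), lambda.
have E u : (f - ad br (z + gM s) - lambda *: delta) u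
    = (f - ad br z) u - br (gM s) u - lambda *: delta u.
  by rewrite !add_lfunE !opp_lfunE scale_lfunE !adE linearDl opprD addrA.
split; first by rewrite !(rpredB, rpredZ, ad_Der).
set g := _ - _ - _ in E *.
(* so(d) commutes with sl2 and [delta] kills sl2, so the vanishing on sl2 survives both
   corrections. *)
have brM_sl a b c : br (gM s) (mk a b c 0 0 0) = 0.
  by rewrite br_anti br_sl_M ?oppr0.
have gsl a b c : (f - ad br z) (mk a b c 0 0 0) = 0 -> g (mk a b c 0 0 0) = 0.
  by rewrite E => ->; rewrite brM_sl deltaE !mkE mulr0 mk0 scaler0 !subr0.
have gZ_0 : g gZ = 0.
  rewrite E gZ0 br_Z deltaE !mkE mulr1 (gZ_scale 2) scalerA subr0 -scalerBl.
  by rewrite mulrC subrr scale0r.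
have gP_0 p : g (gP p) = 0.
  rewrite E gA br_M_P // deltaE !mkE mulr0 /s mulmxBl mul_scalar_mx.
  rewrite [A *m p - _]addrC -scaleNr gPZD scaleNr opprD opprK addrCA subrr.
  by rewrite addr0 subrr.
move=> x Sx; rewrite (mk_decomp x) Sx mk0 addr0 !linearD !linearZ /= gP_0 gZ_0.
by rewrite !gsl // !scaler0 !addr0.
Qed.

(** * Derivations that vanish outside so(d) *)

Section KillingIdeal.
Variable g : 'End(V).
Hypotheses (gDer : g \in Der br) (g0 : forall x, cS x = 0 -> g x = 0).

(** The elements without so(d) component form an ideal killed by g, so [g x] centralizes it.
    Brackets with D remove the H, C and P components, H removes the D component, and the [P_j^(0)]
    remove the so(d) component. *)
Lemma derivation_central x : exists c, g x = c *: gZ.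
Proof.
have brg0 u : cS u = 0 -> br (g x) u = 0.
  move=> Su; have /DerP/(_ x u) := gDer.
  rewrite (g0 Su) linear0r addr0 => <-; apply: g0.
  by rewrite brS Su mul0mx mulmx0 subr0.
set y := g x in brg0 *; have n2 := natK_neq0 1.
have eD := brg0 gD (mkS0 _ _ _ _ _).
have yH : cH y = 0.
  have /eqP := congr1 cH eD; rewrite brH !mkE mulr0 mulr1 sub0r linear0.
  by rewrite mulf_eq0 (negPf n2) oppr_eq0 => /eqP.
have yC : cC y = 0.
  have /eqP := congr1 cC eD; rewrite brC !mkE mulr0 mulr1 sub0r linear0.
  by rewrite mulrNN mulf_eq0 (negPf n2) => /eqP.
have yP : cP y = 0.
  have := congr1 cP eD; rewrite [RHS]linear0 brP_sl !mkE sl_mx_mk.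
  rewrite !(mul0mx, mulmx0, scale0r, scale1r, oppr0, addr0, add0r).
  move=> /matrixP e.
  apply/matrixP => i n; have /eqP := e i n.
  rewrite mxoppE mul_TD !mxE oppr_eq0.
  by rewrite mulf_eq0 (negPf (weight_neq0 _)) => /eqP.
have yD : cD y = 0.
  have /eqP := congr1 cH (brg0 gH (mkS0 _ _ _ _ _)).
  rewrite brH !mkE mulr0 mulr1 subr0 linear0.
  by rewrite mulf_eq0 (negPf n2) => /eqP.
have slY : sl_mx y = 0 by rewrite /sl_mx yD yH yC !scale0r !addr0.
have yS : cS y = 0.
  apply/matrixP => i j.
  have := congr1 cP (brg0 (gP (delta_mx j ord0)) (mkS0 _ _ _ _ _)).
  rewrite [RHS]linear0 brP_sl !mkE slY yP !(mul0mx, mulmx0, addr0, oppr0).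
  by move=> /matrixP/(_ i ord0); rewrite mul_mx_deltaE eqxx mulr1 !mxE.
by exists (cZ y); coordinatewise.
Qed.

(** Both terms of the Leibniz rule are brackets with a multiple of the central M. *)
Lemma derivation_so_commutator s t : s^T = - s -> t^T = - t ->
  g (gM (s *m t - t *m s)) = 0.
Proof.
move=> sT tT; rewrite -br_M_M //; have /DerP -> := gDer.
have [a ->] := derivation_central (gM s).
have [b ->] := derivation_central (gM t).
by rewrite linearZl_LR linearZr_LR /= br_Z br_Z_l !scaler0 addr0.
Qed.

Lemma derivation_so_part x : g x = g (gM (cS x)).
Proof.
apply/eqP; rewrite -subr_eq0 -linearB; apply/eqP/g0.
by rewrite linearB /= mkS ?cS_tr // subrr.
Qed.

(** The matrix by which [M_{ij}] acts on the index of the [P_k^(n)]. *)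
Definition skew_delta (i j : 'I_d) : 'M[K]_d := delta_mx i j - delta_mx j i.

Lemma skew_delta_tr i j : (skew_delta i j)^T = - skew_delta i j.
Proof. by rewrite linearB /= !trmx_delta opprB. Qed.

(** A third index writes each generator of so(d) as a commutator. *)
Lemma skew_delta_commutator i j t : i != j -> t != i -> t != j ->
  skew_delta i t *m skew_delta t j - skew_delta t j *m skew_delta i t
    = skew_delta i j.
Proof.
move=> ij ti tj; rewrite /skew_delta !(mulmxDl, mulmxDr, mulNmx, mulmxN).
rewrite !mul_delta_mx_cond !eqxx [i == t]eq_sym [j == i]eq_sym [j == t]eq_sym.
rewrite (negPf ij) (negPf ti) (negPf tj) !mulr0n !mulr1n.
by rewrite !(oppr0, addr0, add0r, opprK).
Qed.

(** The sum over all ordered pairs meets each [M_{ij}] twice, hence the factor 2; no ordering of i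
    and j is involved. *)
Lemma gM_expand s : s^T = - s ->
  2 *: gM s = \sum_i \sum_j s i j *: gM (skew_delta i j).
Proof.
move=> sT.
have scalar_coord (c : {scalar V}) : (forall t, c (gM t) = 0) ->
    c (2 *: gM s) = c (\sum_i \sum_j s i j *: gM (skew_delta i j)).
  move=> c0; rewrite linearZ /= c0 mulr0 linear_sum big1 // => i _.
  by rewrite linear_sum big1 // => j _; rewrite linearZ /= c0 mulr0.
apply: (coordsP (m := X)).
- by apply: (scalar_coord cD) => t /=; rewrite mkE.
- by apply: (scalar_coord cH) => t /=; rewrite mkE.
- by apply: (scalar_coord cC) => t /=; rewrite mkE.
- by apply: (scalar_coord cZ) => t /=; rewrite mkE.
(* By antisymmetry [2 s = s - s^T]; both terms are expanded in matrix units and paired. *)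
- have sTE : s^T = \sum_i \sum_j s i j *: delta_mx j i.
    rewrite {1}(matrix_sum_delta s) linear_sum; apply: eq_bigr => i _.
    by rewrite linear_sum; apply: eq_bigr => j _; rewrite linearZ /= trmx_delta.
  rewrite linearZ /= mkS // scaler_nat mulr2n -{2}[s]opprK -sT sTE.
  rewrite {1}(matrix_sum_delta s) -sumrB linear_sum; apply: eq_bigr => i _.
  rewrite -sumrB linear_sum; apply: eq_bigr => j _.
  by rewrite [RHS]linearZ /= mkS ?skew_delta_tr // scalerBr.
- rewrite linearZ /= mkE scaler0 linear_sum big1 // => i _.
  by rewrite linear_sum big1 // => j _; rewrite linearZ /= mkE scaler0.
Qed.

Lemma derivation_so_perfect s : d != 2 -> s^T = - s -> g (gM s) = 0.
Proof.
move=> d2 sT; apply: (scalerI (natK_neq0 1)); rewrite scaler0 -linearZ /=.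
rewrite gM_expand // linear_sum big1 // => i _.
rewrite linear_sum big1 // => j _.
rewrite linearZ /=; case: (eqVneq i j) => [->|ij].
  by rewrite /skew_delta subrr mk0 linear0 scaler0.
(* If i and j exhausted the indices, d would be at most 2, hence at most 1 as [d != 2], against i
   and j being distinct. *)
have [t] : exists t, t \notin [:: i; j].
  apply/existsP; rewrite -negb_forall; apply/negP => /forallP ijT.
  have := uniq_leq_size (enum_uniq 'I_d) (s2 := [:: i; j]) (fun t _ => ijT t).
  rewrite size_enum_ord leq_eqVlt (negPf d2) /=.
  have := ltn_ord i; have := ltn_ord j; move: ij; rewrite -val_eqE /=; lia.
rewrite !inE negb_or => /andP[ti tj].
rewrite -(skew_delta_commutator ij ti tj) derivation_so_commutator ?scaler0 //;
exact: skew_delta_tr.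
Qed.

End KillingIdeal.

(** * The mass grading and the direct sum decompositions *)

Section MassGrading.
Variable delta : 'End(V).
Hypothesis deltaE : forall x, delta x = mk 0 0 0 (2 * cZ x) 0 (cP x).
Hypothesis d_gt0 : (0 < d)%N.

(** [delta] is the degree operator of the grading with sl2 and so(d) in degree 0, the [P_i^(n)] in
    degree 1 and M in degree 2. *)
Lemma delta_Der : delta \in Der br.
Proof.
apply/DerP => x y; apply: (coordsP (m := X)); rewrite linearD /= !deltaE.
- by rewrite !brD !mkE; ring.
- by rewrite !brH !mkE; ring.
- by rewrite !brC !mkE; ring.
- by rewrite !brZ_omega !mkE; ring.
- by rewrite !brS !mkE !(mul0mx, mulmx0) !subr0 addr0.
rewrite !brP_sl !mkE !sl_mx_mk.
rewrite !(scale0r, mul0mx, mulmx0, addr0, subr0, oppr0, add0r).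
by rewrite addrA [RHS](ACl (3*1*4*2))%AC.
Qed.

Lemma delta_gZ : delta gZ = 2 *: gZ.
Proof. by rewrite deltaE !mkE mulr1 (gZ_scale 2). Qed.

(** Inner derivations kill the central M, whereas [delta] doubles it. *)
Lemma ad_delta_independent x a : ad br x gZ + a *: delta gZ = 0 -> a = 0.
Proof.
rewrite adE br_Z add0r delta_gZ scalerA => /eqP.
rewrite scaler_eq0 (negPf gZ_neq0) orbF mulf_eq0 (negPf (natK_neq0 1)) orbF.
by move=> /eqP.
Qed.

Lemma directv_Inn_delta : directv (Inn br + <[delta]>)%VS.
Proof.
apply/directv_addP/eqP; rewrite -subv0; apply/subvP => f.
rewrite memv_cap memv0 => /andP[/InnP[x fx] /vlineP[a fa]].
have /ad_delta_independent : ad br x gZ + (- a) *: delta gZ = 0.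
  by rewrite adE -fx fa scale_lfunE scaleNr subrr.
by move=> /eqP; rewrite oppr_eq0 => /eqP a0; rewrite fa a0 scale0r.
Qed.

Lemma mem_Inn_delta x a : ad br x + a *: delta \in (Inn br + <[delta]>)%VS.
Proof.
apply: memv_add; last by rewrite memvZ ?memv_line.
by apply/InnP; exists x => y; rewrite adE.
Qed.

Lemma Inn_delta_sub_Der : (Inn br + <[delta]> <= Der br)%VS.
Proof. by rewrite subv_add Inn_Der //= -memvE delta_Der. Qed.

Theorem Der_mass_coords : d != 2 ->
  Der br = (Inn br + <[delta]>)%VS /\ directv (Inn br + <[delta]>)%VS.
Proof.
move=> d2; split; last exact: directv_Inn_delta.
apply/eqP; rewrite eqEsubv Inn_delta_sub_Der andbT; apply/subvP => f fDer.
have [z [a [gDer g0]]] := derivation_normal_form deltaE delta_Der fDer d_gt0.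
suff -> : f = ad br z + a *: delta by exact: mem_Inn_delta.
apply/eqP; rewrite -subr_eq0 opprD addrA; apply/eqP/lfunP => x.
rewrite (derivation_so_part g0) derivation_so_perfect ?cS_tr //.
by rewrite lfunE.
Qed.

(** The case where so(d) is spanned by [s0], hence abelian: any map from so(d) to the multiples of
    M, extended by 0, is a derivation, and [c] is the coordinate on this line through which [eta]
    factors. *)
Theorem Der_mass_coords_so2 (eta : 'End(V)) (c : 'M[K]_d -> K) (s0 : 'M[K]_d) :
  (forall s, s^T = - s -> exists a, s = a *: s0) -> s0^T = - s0 ->
  (forall a, c (a *: s0) = a * c s0) -> c s0 != 0 ->
  (forall x, eta x = c (cS x) *: gZ) ->
  Der br = (Inn br + <[delta]> + <[eta]>)%VS /\
  directv (Inn br + <[delta]> + <[eta]>)%VS.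
Proof.
move=> span_s0 s0T cZs0 c0 etaE.
have comm (s t : 'M[K]_d) : s^T = - s -> t^T = - t -> s *m t - t *m s = 0.
  move=> sT tT; have [a ->] := span_s0 s sT; have [b ->] := span_s0 t tT.
  by rewrite -!(scalemxAl, scalemxAr) !scalerA mulrC subrr.
have cc0 : c 0 = 0 by have := cZs0 0; rewrite scale0r mul0r.
have etaD : eta \in Der br.
  apply/DerP => x y; rewrite !etaE brS comm ?cS_tr // cc0 scale0r.
  by rewrite linearZl_LR linearZr_LR /= br_Z br_Z_l !scaler0 addr0.
have eta_gZ : eta gZ = 0 by rewrite etaE mkS0 cc0 scale0r.
split.
  apply/eqP; rewrite eqEsubv subv_add Inn_delta_sub_Der -memvE etaD /= andbT.
  apply/subvP => f fDer.
  have [z [a [gDer g0]]] := derivation_normal_form deltaE delta_Der fDer d_gt0.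
  have [b gs0] := derivation_central gDer g0 (gM s0).
  (* The remainder sends [gM s0] to [b *: gZ] and [eta] sends it to [c s0 *: gZ], hence the
     ratio. *)
  have -> : f = ad br z + a *: delta + (b / c s0) *: eta.
    apply/eqP; rewrite -subr_eq0 !opprD !addrA; apply/eqP/lfunP => x.
    rewrite add_lfunE opp_lfunE scale_lfunE etaE (derivation_so_part g0).
    have [e ->] := span_s0 _ (cS_tr X x).
    have -> : gM (e *: s0) = e *: gM s0.
      by coordinatewise; rewrite !mkS // linearZ /= s0T scalerN.
    rewrite linearZ /= gs0 cZs0 !scalerA mulrA mulrAC divfK // [b * e]mulrC.
    by rewrite subrr lfunE.
  by rewrite memv_add ?mem_Inn_delta // memvZ ?memv_line.
rewrite directv_addE /= directv_Inn_delta directvE /= eqxx -subv0.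
apply/subvP => f.
rewrite memv_cap memv0 => /andP[/memv_addP[u /InnP[x ux]] [v /vlineP[a ->]]].
move=> fE /vlineP[b fb].
have uE : u = ad br x by apply/lfunP => y; rewrite ux adE.
(* At M both the inner derivation and [eta] vanish, which isolates [delta]. *)
have a0 : a = 0.
  apply: (@ad_delta_independent x).
  have /lfunP/(_ gZ) : ad br x + a *: delta = b *: eta by rewrite -uE -fE.
  by rewrite add_lfunE !scale_lfunE eta_gZ scaler0.
(* M components arise only from two P components, so an inner derivation gives none on [gM s0],
   whereas [eta] does. *)
have : cZ (f (gM s0)) = 0.
  by rewrite fE a0 scale0r addr0 uE adE brZ_omega !mkE omega0r.
rewrite fb scale_lfunE etaE mkS // !linearZ /= mkE mulr1 => /eqP.
by rewrite mulf_eq0 (negPf c0) orbF => /eqP->; rewrite scale0r.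
Qed.

End MassGrading.

End Derivations.

(** * Coordinates on the mass extension *)

(** Plain functions with linearity proofs are taken, so that composite coordinate expressions can be
    compared without packaging them first. *)
Lemma linear_ext (K : fieldType) (V : vectType K) (W : lmodType K)
    (I : finType) (e : I -> V) (c : I -> V -> K) (F G : V -> W) :
  (forall x, x = \sum_a c a x *: e a) -> linear F -> linear G ->
  (forall a, F (e a) = G (e a)) -> F =1 G.
Proof.
move=> span linF linG FG x.
pose F' : {linear V -> W} := HB.pack F (GRing.isLinear.Build _ _ _ _ F linF).
pose G' : {linear V -> W} := HB.pack G (GRing.isLinear.Build _ _ _ _ G linG).
rewrite -[F]/(F' : V -> W) -[G]/(G' : V -> W) (span x) !linear_sum.
by apply: eq_bigr => a _; rewrite !linearZ /= FG.
Qed.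

Lemma bilinear_ext (K : fieldType) (V : vectType K) (W : lmodType K)
    (I : finType) (e : I -> V) (c : I -> V -> K) (F G : V -> V -> W) :
  (forall x, x = \sum_a c a x *: e a) ->
  (forall y, linear (F^~ y)) -> (forall x, linear (F x)) ->
  (forall y, linear (G^~ y)) -> (forall x, linear (G x)) ->
  (forall a b, F (e a) (e b) = G (e a) (e b)) -> F =2 G.
Proof.
move=> span Fl Fr Gl Gr FG x y.
by apply: (linear_ext (F := F^~ y) (G := G^~ y) span) => // a;
  apply: (linear_ext span).
Qed.

(** * The bracket as a formula on coordinate tuples *)

Section BracketInCoordinates.
Variables (K : fieldType) (d k : nat) (V : vectType K).
Variables (cD cH cC cZ : {scalar V}) (cS : {linear V -> 'M[K]_d}).
Variable cP : {linear V -> 'M[K]_(d, k.*2.+2)}.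
Local Notation TD := (TD K k).
Local Notation TH := (TH K k).
Local Notation TC := (TC K k).
Local Notation L := (k.*2.+1).

Definition coords (x : V) := (cD x, cH x, cC x, cZ x, cS x, cP x).

Definition sl_comb (a b c : K) := a *: TD + b *: TH + c *: TC.

(** The six bracket formulas of [mass_coords] gathered in one tuple, so that each bracket of basis
    elements is checked by a single equation. *)
Definition coords_bracket
    (t u : K * K * K * K * 'M[K]_d * 'M[K]_(d, k.*2.+2)) :=
  let: (a, b, c, z, s, p) := t in let: (a', b', c', z', s', p') := u in
  (c * b' - b * c', 2 * (a * b' - b * a'), - 2 * (a * c' - c * a'),
   \tr (p *m form_mx K k *m p'^T), s *m s' - s' *m s,
   s *m p' - s' *m p + p' *m sl_comb a b c - p *m sl_comb a' b' c').

Definition is_bracket v x y := coords v = coords_bracket (coords x) (coords y).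

(** Each of the six coordinates is bilinear on both sides, so a spanning family suffices. *)
Lemma is_bracket_ext (br : {bilinear V -> V -> V}) (I : finType) (e : I -> V)
    (c : I -> V -> K) : (forall x, x = \sum_a c a x *: e a) ->
  (forall a b, is_bracket (br (e a) (e b)) (e a) (e b)) ->
  forall x y, is_bracket (br x y) x y.
Proof.
move=> span ok x y; congr (_, _, _, _, _, _); move: x y.
1-3: apply: (bilinear_ext (W := K^o) span) =>
    [y a u v|x a u v|y a u v|x a u v|a b];
    rewrite /= ?linearPl ?linearPr ?linearP /= ?linearP /GRing.scale /=;
    by [ring | case: (ok a b)].
- apply: (bilinear_ext (W := K^o) span) =>
    [y a u v|x a u v|y a u v|x a u v|a b].
  + by rewrite /= linearPl linearP.
  + by rewrite linearPr linearP.
  + by rewrite /= linearP /= !mulmxDl -!scalemxAl linearP.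
  + by rewrite linearP /= linearP /= mulmxDr -scalemxAr linearP.
  + by case: (ok a b).
- apply: (bilinear_ext span) => [y a u v|x a u v|y a u v|x a u v|a b].
  + by rewrite /= linearPl linearP.
  + by rewrite linearPr linearP.
  + rewrite /= linearP /= !(mulmxDl, mulmxDr) -scalemxAl -scalemxAr.
    by rewrite opprD scalerBr addrACA.
  + rewrite linearP /= !(mulmxDl, mulmxDr) -scalemxAl -scalemxAr.
    by rewrite opprD scalerBr addrACA.
  + by case: (ok a b).
- have slP a u v : sl_comb (cD (a *: u + v)) (cH (a *: u + v)) (cC (a *: u + v))
      = a *: sl_comb (cD u) (cH u) (cC u) + sl_comb (cD v) (cH v) (cC v).
    rewrite !linearP /sl_comb; apply/matrixP => i j.
    by rewrite !(mxaddE, mxscaleE); ring.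
  apply: (bilinear_ext span) => [y a u v|x a u v|y a u v|x a u v|a b].
  + by rewrite /= linearPl linearP.
  + by rewrite linearPr linearP.
  + rewrite /= slP !linearP /= !(mulmxDl, mulmxDr) -!scalemxAl -!scalemxAr.
    by apply/matrixP => i j; rewrite !(mxaddE, mxoppE, mxscaleE); ring.
  + rewrite /= slP !linearP /= !(mulmxDl, mulmxDr) -!scalemxAl -!scalemxAr.
    by apply/matrixP => i j; rewrite !(mxaddE, mxoppE, mxscaleE); ring.
  + by case: (ok a b).
Qed.

Lemma coordsZ m x a b c z s p : coords x = (a, b, c, z, s, p) ->
  coords (m *: x) = (m * a, m * b, m * c, m * z, m *: s, m *: p).
Proof. by rewrite /coords !linearZ /= => -[-> -> -> -> -> ->]. Qed.

Lemma coordsD x y a b c z s p a' b' c' z' s' p' :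
  coords x = (a, b, c, z, s, p) -> coords y = (a', b', c', z', s', p') ->
  coords (x + y) = (a + a', b + b', c + c', z + z', s + s', p + p').
Proof.
by rewrite /coords !linearD /= => -[-> -> -> -> -> ->] [-> -> -> -> -> ->].
Qed.

Lemma coordsN x a b c z s p : coords x = (a, b, c, z, s, p) ->
  coords (- x) = (- a, - b, - c, - z, - s, - p).
Proof. by rewrite /coords !linearN /= => -[-> -> -> -> -> ->]. Qed.

Lemma coords0 : coords 0 = (0, 0, 0, 0, 0, 0).
Proof. by rewrite /coords !linear0. Qed.

(** The formula is antisymmetric, which settles the pairs listed in the opposite order. *)
Lemma is_bracketN v x y : is_bracket v x y -> is_bracket (- v) y x.
Proof.
case=> vD vH vC vZ vS vP; congr (_, _, _, _, _, _);
  rewrite linearN /= ?vD ?vH ?vC ?vZ ?vS ?vP; try by ring.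
- rewrite -mxtrace_tr !trmx_mul trmxK form_mx_tr mulNmx mulmxN linearN.
  by rewrite opprK mulmxA.
- by rewrite opprB.
- by rewrite !opprD !opprK [RHS](ACl (2*1*4*3))%AC.
Qed.

Lemma coords_bracket_sl a b c a' b' c' :
  coords_bracket (a, b, c, 0, 0, 0) (a', b', c', 0, 0, 0) =
  (c * b' - b * c', 2 * (a * b' - b * a'), - 2 * (a * c' - c * a'), 0, 0, 0).
Proof. by rewrite /= !(mul0mx, subr0, addr0) linear0. Qed.

Lemma coords_bracket_sl_so a b c s :
  coords_bracket (a, b, c, 0, 0, 0) (0, 0, 0, 0, s, 0) = (0, 0, 0, 0, 0, 0).
Proof. by rewrite /= !(mul0mx, mulmx0, mulr0, subr0, addr0) linear0. Qed.

Lemma coords_bracket_sl_P a b c p :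
  coords_bracket (a, b, c, 0, 0, 0) (0, 0, 0, 0, 0, p) =
  (0, 0, 0, 0, 0, p *m sl_comb a b c).
Proof.
by rewrite /= !(mul0mx, mulmx0, mulr0, oppr0, addr0, add0r) ?mxtrace0.
Qed.

Lemma sl_comb0 : sl_comb 0 0 0 = 0.
Proof. by rewrite /sl_comb !scale0r !addr0. Qed.

Lemma coords_bracket_so s s' :
  coords_bracket (0, 0, 0, 0, s, 0) (0, 0, 0, 0, s', 0) =
  (0, 0, 0, 0, s *m s' - s' *m s, 0).
Proof.
by rewrite /= sl_comb0 !(mul0mx, mulmx0, mulr0, oppr0, addr0) ?mxtrace0.
Qed.

Lemma coords_bracket_so_P s p :
  coords_bracket (0, 0, 0, 0, s, 0) (0, 0, 0, 0, 0, p) =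
  (0, 0, 0, 0, 0, s *m p).
Proof.
by rewrite /= sl_comb0 !(mul0mx, mulmx0, mulr0, oppr0, addr0) ?mxtrace0.
Qed.

Lemma coords_bracket_P p q :
  coords_bracket (0, 0, 0, 0, 0, p) (0, 0, 0, 0, 0, q) =
  (0, 0, 0, \tr (p *m form_mx K k *m q^T), 0, 0).
Proof.
by rewrite /= sl_comb0 !(mul0mx, mulmx0, mulr0, subr0, addr0).
Qed.

Lemma coords_bracket_Z t z :
  coords_bracket t (0, 0, 0, z, 0, 0) = (0, 0, 0, 0, 0, 0).
Proof.
case: t => -[[[[a b] c] z'] s] p /=.
by rewrite sl_comb0 trmx0 !(mul0mx, mulmx0, mulr0, oppr0, addr0) ?mxtrace0.
Qed.

End BracketInCoordinates.

(** * The defining relations of [M_{ij}] and [P_i^(n)] on matrix units *)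

Lemma skew_delta_bracket (K : fieldType) d (i j r s : 'I_d) :
  skew_delta K i j *m skew_delta K r s - skew_delta K r s *m skew_delta K i j =
  - (i == r)%:R *: skew_delta K j s - (j == s)%:R *: skew_delta K i r
  + (i == s)%:R *: skew_delta K j r + (j == r)%:R *: skew_delta K i s.
Proof.
rewrite /skew_delta !(mulmxDl, mulmxDr, mulNmx, mulmxN) !mul_delta_mx_cond.
rewrite -!scaler_nat.
rewrite [s == i]eq_sym [s == j]eq_sym [r == i]eq_sym [r == j]eq_sym.
by apply/matrixP => a b; rewrite !(mxaddE, mxoppE, mxscaleE); ring.
Qed.

Lemma skew_delta_P (K : fieldType) d n (i j r : 'I_d) (m : 'I_n) :
  skew_delta K i j *m delta_mx r m =
  - (i == r)%:R *: delta_mx j m + (j == r)%:R *: delta_mx i m.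
Proof.
rewrite /skew_delta mulmxDl mulNmx !mul_delta_mx_cond -!scaler_nat addrC.
by rewrite scaleNr.
Qed.

Section DeltaOscillator.
Variables (K : fieldType) (d k : nat) (i : 'I_d).
Local Notation L := (k.*2.+1).

(** For n > 2l no column matches and the matrix is 0, in agreement with [P_i^(2l+1) = 0]. *)
Definition P_delta (n : nat) : 'M[K]_(d, k.*2.+2) :=
  \matrix_(j, m) ((j == i) && (m == n :> nat))%:R.

Lemma P_deltaE (n : 'I_(k.*2.+2)) : P_delta n = delta_mx i n.
Proof. by apply/matrixP => j m; rewrite !mxE. Qed.

Lemma P_delta_TD (n : 'I_(k.*2.+2)) :
  delta_mx i n *m TD K k = weight K k n *: P_delta n.
Proof.
by apply/matrixP => a b; rewrite mul_delta_mxE !mxE -mulnb natrM; ring.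
Qed.

Lemma P_delta_TH (n : 'I_(k.*2.+2)) :
  delta_mx i n *m TH K k = - n%:R *: P_delta n.-1.
Proof.
apply/matrixP => a b; rewrite mul_delta_mxE !mxE -mulnb natrM.
(* For n = 0 the truncated predecessor is 0 again, and the coefficient [- n%:R] discards it. *)
case: (posnP n) => [->|n_gt0]; first by rewrite oppr0 !mul0r mulr0 ?mul0r.
have -> : (n == b.+1 :> nat) = (b == n.-1 :> nat) by apply/eqP/eqP; lia.
by ring.
Qed.

Lemma P_delta_TC (n : 'I_(k.*2.+2)) :
  delta_mx i n *m TC K k = (L%:R - n%:R) *: P_delta n.+1.
Proof.
by apply/matrixP => a b; rewrite mul_delta_mxE !mxE -mulnb natrM; ring.
Qed.

Lemma P_delta_form m (j : 'I_d) n :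
  \tr (delta_mx i m *m form_mx K k *m (delta_mx j n)^T) =
  (i == j)%:R * (m + n == L)%N%:R * form_coef K k m.
Proof.
have := omega_delta (1%:M : 'M[K]_d) i m j n.
by rewrite mul1mx /omega => ->; rewrite !mxE eq_sym mulrA.
Qed.

End DeltaOscillator.

(** * Coordinate functions on [ghat] *)

Section Coordinates.
Variables (R : realType) (d k : nat).
Local Notation K := R[i].
Local Notation V := (ghat R d k).
Local Notation bas := (bas R).
Local Notation N := (k.*2.+2).

Lemma eqGM (p q : pairs d) : (GM p == GM q :> gen d k) = (p == q).
Proof. by apply/eqP/eqP => [[]|->]. Qed.

Lemma eqGP i j m n : (GP i m == GP j n :> gen d k) = (i == j) && (m == n).
Proof. by rewrite -xpair_eqE; apply/eqP/eqP => [[-> ->]|[-> ->]]. Qed.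

(** Evaluation retyped with values in the field itself instead of its regular module. *)
Definition co (a : gen d k) (x : V) : K := x a.

Lemma coD a x y : co a (x + y) = co a x + co a y.
Proof. by rewrite /co ffunE. Qed.
Lemma co0 a : co a 0 = 0.
Proof. by rewrite /co ffunE. Qed.
Lemma coN a x : co a (- x) = - co a x.
Proof. by rewrite /co ffunE. Qed.
Lemma coZ a (c : K) x : co a (c *: x) = c * co a x.
Proof. by rewrite /co ffunE. Qed.
Lemma co_sum a (I : Type) (r : seq I) (P : pred I) (F : I -> V) :
  co a (\sum_(i <- r | P i) F i) = \sum_(i <- r | P i) co a (F i).
Proof. exact: (big_morph (co a) (coD a) (co0 a)). Qed.
Lemma co_bas a b : co a (bas b) = (a == b)%:R.
Proof. by rewrite /co ffunE. Qed.

Lemma coP (x y : V) : (forall a, co a x = co a y) -> x = y.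
Proof. by move=> e; apply/ffunP. Qed.

Lemma ghat_basE (x : V) : x = \sum_a co a x *: bas a.
Proof.
apply: coP => b; rewrite co_sum.
rewrite (eq_bigr (fun a => co a x * (b == a)%:R)); last first.
  by move=> a _; rewrite [LHS]coZ co_bas.
rewrite (bigD1 b) // eqxx mulr1 big1 => [|a ab]; first by rewrite /= addr0.
by rewrite eq_sym (negPf ab) mulr0.
Qed.

(** The case split is that of [Mij], so that [M_{ij}] receives the matrix unit (i, j) minus its
    transpose. *)
Definition so_entry (x : V) i j : K :=
  if insub (i, j) is Some p then co (GM p) x
  else if insub (j, i) is Some p then - co (GM p) x else 0.
Definition so_part (x : V) : 'M[K]_d := \matrix_(i, j) so_entry x i j.

Lemma so_part_is_linear : linear so_part.
Proof.
move=> a x y; apply/matrixP => i j; rewrite !mxE /so_entry.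
case: insub => [p|]; first by rewrite coD coZ.
case: insub => [p|]; last by rewrite mulr0 addr0.
by rewrite coD coZ opprD mulrN.
Qed.
HB.instance Definition _ := GRing.isLinear.Build K V 'M[K]_d _ so_part
  so_part_is_linear.

Definition P_part (x : V) : 'M[K]_(d, N) := \matrix_(i, n) co (GP i n) x.

Lemma P_part_is_linear : linear P_part.
Proof. by move=> a x y; apply/matrixP => i j; rewrite !mxE coD coZ. Qed.
HB.instance Definition _ := GRing.isLinear.Build K V 'M[K]_(d, N) _ P_part
  P_part_is_linear.

Lemma so_part_tr x : (so_part x)^T = - so_part x.
Proof.
apply/matrixP => i j; rewrite !mxE /so_entry.
case: insubP => [p /= ji _|_]; case: insubP => [q /= ij _|_] //=.
- by have := ltn_trans ij ji; rewrite ltnn.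
- by rewrite opprK.
- by rewrite oppr0.
Qed.

Lemma so_partE x (p : pairs d) : so_part x (val p).1 (val p).2 = co (GM p) x.
Proof. by rewrite mxE /so_entry -surjective_pairing valK. Qed.

Lemma so_part_bas (a : gen d k) : so_part (bas a) =
  if a is GM p then delta_mx (val p).1 (val p).2 - delta_mx (val p).2 (val p).1
  else 0.
Proof.
apply/matrixP => i j; rewrite mxE /so_entry.
case: a => [||||r n|]; try by
  rewrite !mxE; do 2?[case: insubP => [? _ _|_]]; rewrite ?co_bas ?oppr0.
move=> q; rewrite !mxE.
case: q => -[u v] uv; rewrite /=.
have {}uv' : (u < v)%N by exact: uv.
case: insubP => [p pP pE|nij].
  rewrite co_bas eqGM -val_eqE /= pE xpair_eqE.
  (* The transposed unit contributes only if (j, i) = (u, v), which contradicts i < j. *)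
  case: (j =P u) => [ju|_]; rewrite ?andbF ?subr0 //.
  case: (i =P v) => [iv|_]; rewrite ?andbF ?subr0 //.
  by move: pP; rewrite /= ju iv => /(ltn_trans uv'); rewrite ltnn.
case: insubP => [p pP pE|nji].
  rewrite co_bas eqGM -val_eqE /= pE xpair_eqE.
  rewrite [(j == u) && _]andbC; case: (i =P u) => [iu|_]; rewrite ?sub0r //.
  case: (j =P v) => [jv|_]; rewrite ?sub0r //.
  by move: pP; rewrite /= iu jv => /(ltn_trans uv'); rewrite ltnn.
have -> : (i == u) && (j == v) = false.
  by apply: contraNF nij => /andP[/eqP-> /eqP->].
have -> : (i == v) && (j == u) = false.
  by apply: contraNF nji => /andP[/eqP-> /eqP->].
by rewrite subrr.
Qed.

Lemma P_part_bas (a : gen d k) :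
  P_part (bas a) = if a is GP i n then delta_mx i n else 0.
Proof.
apply/matrixP => i n; rewrite mxE co_bas.
by case: a => [||||j m|]; rewrite ?mxE // eqGP.
Qed.

Lemma so_part_Mij i j : so_part (Mij R k i j) = delta_mx i j - delta_mx j i.
Proof.
rewrite /Mij; case: insubP => [p _ pE|nij].
  by rewrite so_part_bas pE.
case: insubP => [p _ pE|nji].
  by rewrite linearN /= so_part_bas pE opprB.
have -> : i = j by apply/val_inj/eqP; rewrite eqn_leq leqNgt nji leqNgt nij.
by rewrite subrr linear0.
Qed.

Lemma P_part_Mij i j : P_part (Mij R k i j) = 0.
Proof.
rewrite /Mij; case: insubP => [p _ _|_]; first by rewrite P_part_bas.
by case: insubP => [p _ _|_]; rewrite ?linearN /= ?P_part_bas ?oppr0 ?linear0.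
Qed.

Lemma so_part_Pin i n : so_part (Pin R k i n) = 0.
Proof.
by rewrite /Pin; case: insubP => [m _ _|_]; rewrite ?so_part_bas ?linear0.
Qed.

Lemma P_part_Pin i n :
  P_part (Pin R k i n) = \matrix_(j, m) ((j == i) && (m == n :> nat))%:R.
Proof.
rewrite /Pin; case: insubP => [m mN <-|nN].
  by rewrite P_part_bas; apply/matrixP => j u; rewrite !mxE.
rewrite linear0; apply/matrixP => j u; rewrite !mxE.
case: (_ =P n :> nat) => [un|_]; last by rewrite andbF.
by move: nN; rewrite -un ltn_ord.
Qed.

Lemma co_Mij i j a : (if a is GM _ then false else true) ->
  co a (Mij R k i j) = 0.
Proof.
rewrite /Mij; case: insubP => [p _ _|_]; last case: insubP => [p _ _|_];
by case: a => //= *; rewrite ?coN ?co_bas ?co0 ?oppr0.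
Qed.

Lemma co_Pin i n a : (if a is GP _ _ then false else true) ->
  co a (Pin R k i n) = 0.
Proof.
rewrite /Pin; case: insubP => [p _ _|_];
by case: a => //= *; rewrite ?co_bas ?co0.
Qed.

Lemma co_is_scalar a : scalar (co a).
Proof. by move=> c x y; rewrite coD coZ. Qed.
HB.instance Definition _ a := GRing.isLinear.Build K V K _ (co a)
  (co_is_scalar a).

(** * Comparison with the listed brackets of basis elements *)

Local Notation gcoords :=
  (coords (co GD) (co GH) (co GC) (co GZ) so_part P_part).
Local Notation is_gbracket :=
  (is_bracket (co GD) (co GH) (co GC) (co GZ) so_part P_part).

Lemma coordsE x : gcoords x =
  (co GD x, co GH x, co GC x, co GZ x, so_part x, P_part x).
Proof. by []. Qed.

Definition sl_coords (a : gen d k) : K * K * K * K :=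
  match a with
  | GD => (1, 0, 0, 0) | GH => (0, 1, 0, 0) | GC => (0, 0, 1, 0)
  | GZ => (0, 0, 0, 1) | _ => (0, 0, 0, 0)
  end.

Lemma coords_bas a : gcoords (bas a) = (sl_coords a,
  (if a is GM p then skew_delta K (val p).1 (val p).2 else 0),
  (if a is GP i n then delta_mx i n else 0)).
Proof.
rewrite coordsE !co_bas so_part_bas P_part_bas.
have eqsl (b : gen d k) : match b with GM _ | GP _ _ => False | _ => True end ->
    (b == a) = match b, a with
      | GD, GD | GH, GH | GC, GC | GZ, GZ => true | _, _ => false end.
  by case: b; case: a => *; apply/eqP.
by rewrite !eqsl //; case: a {eqsl}.
Qed.

Lemma coords_Mij i j :
  gcoords (Mij R k i j) = (0, 0, 0, 0, skew_delta K i j, 0).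
Proof. by rewrite coordsE !co_Mij // so_part_Mij P_part_Mij. Qed.

Lemma coords_Pin i n : gcoords (Pin R k i n) = (0, 0, 0, 0, 0, P_delta K k i n).
Proof. by rewrite coordsE !co_Pin // so_part_Pin P_part_Pin. Qed.

Lemma weight_ell n : 2 * (ell R k - n%:R) = weight K k n.
Proof.
by rewrite /ell /weight -addn1 -!muln2 natrD !natrM; field.
Qed.

Arguments coords_bracket : simpl never.

Definition coords_simpl :=
  (mulr0, mulr1, mul0r, scaler0, scale0r, addr0, add0r, subr0, sub0r, oppr0).

Lemma two_ell : 2 * ell R k = k.*2.+1%:R.
Proof. by rewrite /ell -[k.*2.+1]addn1 -muln2 natrD natrM; field. Qed.

Lemma listed_bracket_ok a b v : listed_bracket R a b = Some v ->
  is_gbracket v (bas a) (bas b).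
Proof.
rewrite /is_bracket !coords_bas.
case: a b => [|||[[i j] ij]|i m|] [|||[[r s] rs]|r n|] //= [<-].
- rewrite (coordsZ _ (coords_bas GH)) coords_bracket_sl.
  by rewrite !coords_simpl.
- rewrite (coordsZ _ (coords_bas GC)) coords_bracket_sl.
  by rewrite !coords_simpl.
- rewrite (coordsZ _ (coords_Pin r n)) coords_bracket_sl_P /sl_comb weight_ell.
  by rewrite !coords_simpl scale1r P_delta_TD.
- rewrite (coordsZ _ (coords_Pin r n.-1)) coords_bracket_sl_P /sl_comb.
  by rewrite !coords_simpl scale1r P_delta_TH.
- rewrite (coords_bas GD) coords_bracket_sl.
  by rewrite !coords_simpl.
- rewrite (coordsZ _ (coords_Pin r n.+1)) coords_bracket_sl_P /sl_comb.
  by rewrite !coords_simpl scale1r P_delta_TC two_ell.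
- have cM m u v := coordsZ m (coords_Mij u v).
  rewrite (coordsD (coordsD (coordsD (cM _ _ _) (coordsN (cM _ _ _)))
    (cM _ _ _)) (cM _ _ _)).
  by rewrite coords_bracket_so !coords_simpl skew_delta_bracket.
- rewrite (coordsD (coordsZ _ (coords_Pin _ _)) (coordsZ _ (coords_Pin _ _))).
  by rewrite coords_bracket_so_P !coords_simpl skew_delta_P !P_deltaE.
- rewrite (coordsZ _ (coords_bas GZ)) coords_bracket_P.
  by rewrite !coords_simpl P_delta_form.
Qed.

Lemma bracket_ok a b : is_gbracket (bracket (bas a) (bas b)) (bas a) (bas b).
Proof.
rewrite bracketE /bracket_gen.
case lab: listed_bracket => [v|]; first exact: listed_bracket_ok.
case lba: listed_bracket => [v|].
  by apply: is_bracketN; apply: listed_bracket_ok.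
(* The pairs listed in neither order are, up to exchange, an sl2 generator with itself, sl2 with
   so(d), and anything with M; the formula gives 0 on them. *)
have ok0 (u v : gen d k) : match u, v with
    | _, GZ | GD, GD | GH, GH | GC, GC | (GD | GH | GC), GM _ => True
    | _, _ => False end -> is_gbracket 0 (bas u) (bas v).
  rewrite /is_bracket coords0 !coords_bas.
  by case: u v => [|||p|i m|] [|||q|j n|] //= _;
    rewrite ?coords_bracket_sl ?coords_bracket_sl_so ?coords_bracket_Z
            ?coords_simpl.
have ok0' u v : is_gbracket 0 (bas v) (bas u) -> is_gbracket 0 (bas u) (bas v).
  by move=> /is_bracketN; rewrite oppr0.
case: a b lab lba => [|||[[i j] ij]|i m|] [|||[[r s] rs]|r n|] //= _ _;
  by [exact: ok0 | apply: ok0'; exact: ok0].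
Qed.

(** * The coordinate structure of [ghat], with [deltaM] and [etaM] expressed in it *)

Definition ghat_mk (a b c z : K) (s : 'M[K]_d) (p : 'M[K]_(d, N)) : V :=
  [ffun g => match g with
   | GD => a | GH => b | GC => c | GZ => z
   | GM q => s (val q).1 (val q).2
   | GP i n => p i n end].

Lemma so_part_mk a b c z (s : 'M[K]_d) p :
  s^T = - s -> so_part (ghat_mk a b c z s p) = s.
Proof.
move=> /matrixP sT; apply/matrixP => i j.
have := sT i j; rewrite !mxE /so_entry => sij.
case: insubP => [q _ qE|nij]; first by rewrite /co ffunE qE.
case: insubP => [q _ qE|nji]; first by rewrite /co ffunE qE sij opprK.
have ij : i = j by apply/val_inj/eqP; rewrite eqn_leq leqNgt nji leqNgt nij.
(* On the diagonal antisymmetry gives [2 s_ii = 0], matching the default 0 of [so_entry]. *)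
move: sij; rewrite ij => /eqP; rewrite -addr_eq0 -mulr2n -mulr_natl.
by rewrite mulf_eq0 pnatr_eq0 /= => /eqP.
Qed.

Lemma ghat_bracket x y : is_gbracket (bracket x y) x y.
Proof. exact: (is_bracket_ext ghat_basE bracket_ok). Qed.

(** Left transparent, so that its projections unfold to [co], [so_part], [P_part] and [ghat_mk] when
    the formulas for [deltaM] and [etaM] are supplied. *)
Definition ghat_coords : mass_coords d k (@bracket R d k).
Proof.
apply: (@MassCoords K d k V _ (co GD) (co GH) (co GC) (co GZ) so_part P_part
  _ _ _ _ _ _ ghat_mk).
- exact: co_is_scalar.
- exact: co_is_scalar.
- exact: co_is_scalar.
- exact: co_is_scalar.
- exact: so_part_is_linear.
- exact: P_part_is_linear.
- exact: so_part_tr.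
- by move=> *; rewrite /co ffunE.
- by move=> *; rewrite /co ffunE.
- by move=> *; rewrite /co ffunE.
- by move=> *; rewrite /co ffunE.
- exact: so_part_mk.
- by move=> *; apply/matrixP => i n; rewrite mxE /co ffunE.
- move=> x y eD eH eC eZ es ep; apply/coP; case=> // [p|i n].
    by rewrite -!so_partE es.
  by have /matrixP/(_ i n) := ep; rewrite !mxE.
- by move=> x y; case: (ghat_bracket x y).
- by move=> x y; case: (ghat_bracket x y).
- by move=> x y; case: (ghat_bracket x y).
- by move=> x y; case: (ghat_bracket x y).
- by move=> x y; case: (ghat_bracket x y).
- by move=> x y; case: (ghat_bracket x y).
Defined.

Lemma deltaM_ghat_mk x :
  deltaM R d k x = ghat_mk 0 0 0 (2 * co GZ x) 0 (P_part x).
Proof.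
(* [deltaM] is diagonal in the basis, with eigenvalues w. *)
pose w (a : gen d k) : K := match a with GP _ _ => 1 | GZ => 2 | _ => 0 end.
suff deltaMw b y : co b (deltaM R d k y) = w b * co b y.
  apply: coP => b; rewrite deltaMw [RHS]/co ffunE /w.
  by case: b => [|||p|i n|]; rewrite ?mul0r ?mul1r ?mxE.
suff: (fun y => co b (deltaM R d k y)) =1 (fun y => w b * co b y) by exact.
apply: (linear_ext (W := K^o) ghat_basE).
- by move=> a u v; rewrite !linearP.
- by move=> a u v; rewrite coD coZ mulrDr mulrCA.
move=> a; rewrite /deltaM lin_extE co_bas.
case: (eqVneq b a) => [->|ba]; last first.
  by case: a ba => [|||p|i n|] ba;
    rewrite ?coZ ?co0 ?co_bas ?(negPf ba) ?mulr0.
case: a => *; rewrite ?coZ ?co0 ?co_bas ?eqxx ?mulr1 ?mul0r //.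
Qed.

End Coordinates.

Lemma etaM_so_part (R : realType) k x : etaM R k x =
  ('i%C * so_part x ord0 ord_max) *: ghat_mk 0 0 0 1 0 0.
Proof.
have -> : ghat_mk 0 0 0 1 0 0 = bas R GZ :> ghat R 2 k.
  apply: coP => b; rewrite co_bas; case: (eqVneq b GZ) => [->|bZ].
    by rewrite /co ffunE.
  by case: b bZ => [|||p|i n|] bZ; rewrite /co ffunE ?mxE // eqxx in bZ *.
move: x; apply: (linear_ext (@ghat_basE R 2 k)).
- by move=> a x y; rewrite linearP.
- move=> a x y; rewrite linearP mxaddE mxscaleE mulrDr scalerDl scalerA.
  by rewrite mulrCA.
move=> a; rewrite /etaM lin_extE so_part_bas.
case: a => [|||[[i j] ij]|i n|]; rewrite ?mxE ?mulr0 ?scale0r //=.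
(* For d = 2 there is a single pair i < j. *)
have [i0 j1] : i = ord0 /\ j = ord_max.
  by move: ij => /=; case: i j => -[|[|i]] // iP [] -[|[|j]] // jP _;
    split; apply: val_inj.
by rewrite i0 j1 !eqxx /= subr0 mulr1.
Qed.

Lemma skew_so2 (K : fieldType) (s : 'M[K]_2) : 2 != 0 :> K -> s^T = - s ->
  s = s ord0 ord_max *: skew_delta K ord0 ord_max.
Proof.
move=> n2 /matrixP sT.
have s0 i : s i i = 0.
  have /eqP := sT i i; rewrite !mxE -addr_eq0 -mulr2n -mulr_natl.
  by rewrite mulf_eq0 (negPf n2) => /eqP.
have {}sT i j : s j i = - s i j by have := sT i j; rewrite !mxE.
have ordE (i : 'I_2) : i = ord0 \/ i = ord_max.
  by case: i => -[|[|i]] // iP; [left|right]; apply: val_inj.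
apply/matrixP => i j; rewrite !mxE.
by case: (ordE i) (ordE j) => -> [] ->;
  rewrite ?s0 ?[s ord_max ord0]sT /= ?subrr ?subr0 ?sub0r ?mulr0 ?mulrN ?mulr1.
Qed.

Theorem theorem3p4 (R : realType) (k : nat) :
  (forall d : nat, (0 < d)%N -> d != 2%N ->
     Der (@bracket R d k)
       = (Inn (@bracket R d k) + <[deltaM R d k]>)%VS /\
     directv (Inn (@bracket R d k) + <[deltaM R d k]>)%VS) /\
  (Der (@bracket R 2 k)
     = (Inn (@bracket R 2 k) + <[deltaM R 2 k]> + <[etaM R k]>)%VS /\
   directv (Inn (@bracket R 2 k) + <[deltaM R 2 k]> + <[etaM R k]>)%VS).
Proof.
have charC : [pchar R[i]] =i pred0 by exact: pchar_num.
split=> [d d_gt0 d2|].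
  exact: (Der_mass_coords (X := ghat_coords R d k) charC
            (@deltaM_ghat_mk R d k) d_gt0 d2).
(* As [s = - i M_{12}] goes to M, [M_{12}] goes to [i M]; hence the factor ['i%C] in the coordinate
   on so(2). *)
apply: (@Der_mass_coords_so2 _ _ _ _ _ (ghat_coords R 2 k) charC _
  (@deltaM_ghat_mk R 2 k) isT _ (fun s => 'i%C * s ord0 ord_max)
  (skew_delta _ ord0 ord_max)).
- move=> s sT; exists (s ord0 ord_max); apply: skew_so2 sT.
  by rewrite pnatr_eq0.
- exact: skew_delta_tr.
- by move=> a; rewrite mxscaleE mulrCA.
- by rewrite !mxE !eqxx /= subr0 mulr1 neq0Ci.
- exact: etaM_so_part.
Qed.
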